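(* Let $p$ be a prime, let $i \ge 1$, and let $\lambda \in \mathcal{C}^i_p$ with $\lambda \vdash n$. Then: (a) There exists a successor of $\lambda$ in $\mathcal{C}^i_p$; that is, there exists $\mu \in \lambda+$ such that $p$ divides $|H^i(\Sigma_{n+1},S^\mu_{\mathbb{Z}})|$. (b) If $p \nmid n$, then there exists a predecessor of $\lambda$ in $\mathcal{C}^i_p$; that is, there exists $\mu \in \lambda-$ such that $p$ divides $|H^i(\Sigma_{n-1},S^\mu_{\mathbb{Z}})|$.
   Context: $\Sigma_n$ is the symmetric group on $n$ letters, and $\lambda \vdash n$ means that $\lambda$ is a partition of $n$. $S^\lambda_{\mathbb{Z}}$ is the integral Specht module in James' convention (the $\mathbb{Z}\Sigma_n$-submodule of the permutation module on $\lambda$-tabloids spanned by polytabloids, so $S^{(n)}_{\mathbb{Z}}$ is trivial). For $i \ge 1$, $H^i(\Sigma_n,S^\lambda_{\mathbb{Z}})$ is finite, and $\mathcal{C}^i_p := \bigcup_{n \in \mathbb{Z}_{\ge 0}} \{\lambda \vdash n \mid p \text{ divides } |H^i(\Sigma_n,S^\lambda_{\mathbb{Z}})|\}$. For a partition $\lambda$, $\lambda+$ (resp. $\lambda-$) denotes the set of partitions obtained from $\lambda$ by adding (resp. removing) one node of its Young diagram. For a set $S$ of partitions and $\lambda,\mu\in S$ with $\mu \in \lambda+$, $\lambda$ is called a predecessor of $\mu$ in $S$ and $\mu$ a successor of $\lambda$ in $S$. *)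

(* Defs.v *)
From HB Require Import structures.
From mathcomp Require Import all_boot all_order all_algebra all_fingroup.
From mathcomp Require Import boolp classical_sets functions cardinality.

Set Implicit Arguments.
Unset Strict Implicit.
Unset Printing Implicit Defensive.

Import GRing.Theory Num.Theory.

Local Open Scope ring_scope.

(* Partitions are weakly decreasing lists of positive parts, so distinct      *)
(* lists are distinct partitions and [::] is the partition of 0.              *)

Definition is_part (la : seq nat) : bool := sorted geq la && (0 \notin la)%N.

Definition part_of (n : nat) (la : seq nat) : bool :=
  is_part la && (sumn la == n).

(* The node in row r and column c is the pair (r, c), both counted from 0.    *)
Definition young (la : seq nat) : pred (nat * nat) :=
  fun x => (x.2 < nth 0 la x.1)%N.

Definition in_add (la mu : seq nat) : Prop :=
  is_part mu /\ exists2 x, x \notin young la & young mu =i predU1 x (young la).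

Definition in_rem (la mu : seq nat) : Prop := is_part mu /\ in_add mu la.

Definition successor (C : set (seq nat)) (la mu : seq nat) : Prop :=
  [/\ C la, C mu & in_add la mu].

Definition predecessor (C : set (seq nat)) (la mu : seq nat) : Prop :=
  successor C mu la.

Record gmodule (G : finGroupType) := GModule {
  gmodule_sort :> zmodType;
  gact : G -> gmodule_sort -> gmodule_sort;
  gactD : forall g, {morph gact g : u v / u + v};
  gact1 : forall u, gact 1%g u = u;
  gactM : forall g h u, gact (g * h)%g u = gact g (gact h u)
}.

(* The cohomology of the inhomogeneous bar complex: an i-cochain is a map     *)
(* from G^i to M, and the differential of f at (g_0, .., g_i) is              *)
(*   g_0 f(g_1, ..) + \sum_(k < i) (-1)^(k+1) f(.., g_k g_(k+1), ..)          *)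
(*   + (-1)^(i+1) f(g_0, .., g_(i-1)).                                        *)

Section Cohomology.

Variables (G : finGroupType) (M : gmodule G).

Definition cochain (i : nat) := {ffun {ffun 'I_i -> G} -> M}.

(* lift ord_max j has value j and lift ord0 j has value j + 1. *)
Definition bar_init i (g : {ffun 'I_i.+1 -> G}) : {ffun 'I_i -> G} :=
  [ffun j : 'I_i => g (lift ord_max j)].

Definition bar_tail i (g : {ffun 'I_i.+1 -> G}) : {ffun 'I_i -> G} :=
  [ffun j : 'I_i => g (lift ord0 j)].

Definition bar_merge i (k : 'I_i) (g : {ffun 'I_i.+1 -> G}) :
    {ffun 'I_i -> G} :=
  [ffun j : 'I_i => if (j < k)%N then g (lift ord_max j)
                   else if j == k then (g (lift ord_max j) * g (lift ord0 j))%g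
                   else g (lift ord0 j)].

Definition coboundary_map i (f : cochain i) : cochain i.+1 :=
  [ffun g : {ffun 'I_i.+1 -> G} =>
     gact (g ord0) (f (bar_tail g))
     + \sum_(k < i) f (bar_merge k g) *~ (-1) ^+ k.+1
     + f (bar_init g) *~ (-1) ^+ i.+1].

Lemma coboundary_mapB i : {morph @coboundary_map i : f h / f - h}.
Proof.
have actN g (u : M) : gact g (- u) = - gact g u.
  apply: (addrI (gact g u)); rewrite -gactD !subrr.
  by apply: (addrI (gact g 0)); rewrite -gactD !addr0.
move=> f h; apply/ffunP=> g; rewrite !ffunE gactD actN !mulrzBl.
under eq_bigr => k _ do rewrite !ffunE mulrzBl.
by rewrite sumrB !opprD [X in X + _ = _]addrACA [LHS]addrACA.
Qed.

Lemma coboundary_map0 i : coboundary_map (0 : cochain i) = 0.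
Proof. by rewrite -(subrr 0) coboundary_mapB subrr. Qed.

Definition is_cocycle i : pred (cochain i) := fun f => coboundary_map f == 0.

Lemma is_cocycle_zmod i : zmod_closed (@is_cocycle i).
Proof.
split=> [|f h]; rewrite !unfold_in; first by rewrite coboundary_map0.
by move=> /eqP f0 /eqP h0; rewrite coboundary_mapB f0 h0 subrr.
Qed.

HB.instance Definition _ i :=
  GRing.isZmodClosed.Build (cochain i) (@is_cocycle i) (@is_cocycle_zmod i).

Record cocycle i := Cocycle {
  cocycle_val : cochain i;
  _ : is_cocycle cocycle_val
}.

HB.instance Definition _ i := [isSub for @cocycle_val i].
HB.instance Definition _ i := [Choice of cocycle i by <:].
HB.instance Definition _ i := [SubChoice_isSubZmodule of cocycle i by <:].

Definition coboundary_prop i : cochain i -> Prop :=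
  match i return cochain i -> Prop with
  | 0 => fun f => f = 0
  | j.+1 => fun f => exists h : cochain j, f = coboundary_map h
  end.

Definition is_coboundary i : pred (cocycle i) :=
  fun f => `[< coboundary_prop (val f) >].

Lemma is_coboundary_zmod i : zmod_closed (@is_coboundary i).
Proof.
split=> [|f h]; rewrite !unfold_in.
  apply/asboolP; case: i => [|i] //=.
  by exists 0; rewrite coboundary_map0.
case: i f h => [|i] f h /asboolP /= => [f0|[u fu]] /asboolP /= => [h0|[v hv]].
  by apply/asboolP; rewrite /= f0 h0 subrr.
by apply/asboolP; exists (u - v); rewrite coboundary_mapB -fu -hv.
Qed.

HB.instance Definition _ i :=
  GRing.isZmodClosed.Build (cocycle i) (@is_coboundary i) (@is_coboundary_zmod i).

Definition cohomology (i : nat) : zmodType := Quotient.quot (GRing.ZmodClosed.clone _ (@is_coboundary i) _).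

End Cohomology.

(* p divides |T|; false when T is infinite. *)
Definition dvd_order (p : nat) (T : Type) : Prop :=
  exists2 N : nat, ([set: T] #= `I_N)%card & (p %| N)%N.

Section Specht.

Variables (n : nat) (la : seq nat).

Definition node :=
  {x : 'I_(size la) * 'I_(head 0%N la) | (val x.1, val x.2) \in young la}.
Definition node_row (a : node) : nat := (val a).1.
Definition node_col (a : node) : nat := (val a).2.

Definition is_tableau (t : {ffun node -> 'I_n}) : bool :=
  injectiveb t && [forall x, x \in codom t].

Definition tableau := {t : {ffun node -> 'I_n} | is_tableau t}.

(* t and u are row equivalent when every letter is in the same row in both. *)
Definition row_equiv (t u : tableau) : bool :=
  [forall a, forall b, (val t a == val u b) ==> (node_row a == node_row b)].

Definition row_class (t : tableau) : {set tableau} := [set u | row_equiv t u].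

Definition tabloid := {T : {set tableau} | T \in codom row_class}.

Lemma row_class_codom (t : tableau) : row_class t \in codom row_class.
Proof. exact: codom_f. Qed.

Definition tabloid_of (t : tableau) : tabloid :=
  exist _ (row_class t) (row_class_codom t).

Lemma tableau_act_subproof (t : tableau) (s : 'S_n) :
  is_tableau [ffun a => s (val t a)].
Proof.
case: t => t /= /andP[/injectiveP t_inj /forallP t_surj]; apply/andP; split.
  by apply/injectiveP=> a b; rewrite !ffunE => /perm_inj/t_inj.
apply/forallP=> x; have /codomP[a sx] := t_surj ((s^-1)%g x).
by apply/codomP; exists a; rewrite ffunE -sx permKV.
Qed.

Definition tableau_act (t : tableau) (s : 'S_n) : tableau :=
  exist (fun u => is_true (is_tableau u)) _ (tableau_act_subproof t s).

Lemma tableau_act1 t : tableau_act t 1%g = t.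
Proof. by apply/val_inj/ffunP=> a; rewrite /= ffunE perm1. Qed.

Lemma tableau_actM t s s' :
  tableau_act t (s * s')%g = tableau_act (tableau_act t s) s'.
Proof. by apply/val_inj/ffunP=> a; rewrite /= !ffunE permM. Qed.

Lemma row_equiv_act s t u :
  row_equiv (tableau_act t s) (tableau_act u s) = row_equiv t u.
Proof.
apply: eq_forallb => a; apply: eq_forallb => b.
by rewrite /= !ffunE (inj_eq perm_inj).
Qed.

Lemma row_class_act t s :
  [set tableau_act u s | u in row_class t] = row_class (tableau_act t s).
Proof.
apply/setP=> u; rewrite inE; apply/imsetP/idP => [[w]|tu].
  by rewrite inE => tw ->; rewrite row_equiv_act.
have uE : u = tableau_act (tableau_act u (s^-1)%g) s.
  by rewrite -tableau_actM mulVg tableau_act1.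
by exists (tableau_act u (s^-1)%g) => //; rewrite inE -(row_equiv_act s) -uE.
Qed.

Lemma tabloid_act_subproof (T : tabloid) (s : 'S_n) :
  [set tableau_act u s | u in val T] \in codom row_class.
Proof.
by case: T => T /= /codomP[t ->]; rewrite row_class_act row_class_codom.
Qed.

Definition tabloid_act (T : tabloid) (s : 'S_n) : tabloid :=
  exist (fun U => is_true (U \in codom row_class)) _ (tabloid_act_subproof T s).

Lemma tabloid_act_of t s : tabloid_act (tabloid_of t) s = tabloid_of (tableau_act t s).
Proof. by apply/val_inj; rewrite /= row_class_act. Qed.

Lemma tabloid_ofP (T : tabloid) : exists t, T = tabloid_of t.
Proof.
by case: T => T TP; have /codomP[t tE] := TP; exists t; apply/val_inj.
Qed.

Lemma tabloid_act1 T : tabloid_act T 1%g = T.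
Proof. by have [t ->] := tabloid_ofP T; rewrite tabloid_act_of tableau_act1. Qed.

Lemma tabloid_actM T s s' :
  tabloid_act T (s * s')%g = tabloid_act (tabloid_act T s) s'.
Proof. by have [t ->] := tabloid_ofP T; rewrite !tabloid_act_of tableau_actM. Qed.

Definition perm_module := {ffun tabloid -> int}.

Definition tabloid_basis (T : tabloid) : perm_module := [ffun U => (U == T)%:R].

(* The product s * s' of permutations is "s, then s'", so permuting letters   *)
(* is a right action; it becomes a left action by letting s send the basis    *)
(* vector of T to that of T acted on by s^-1 (lemma perm_module_act_basis).   *)
(* Inversion identifies this with the usual left module over the symmetric    *)
(* group whose product is right-to-left composition.                          *)
Definition perm_module_act (s : 'S_n) (v : perm_module) : perm_module :=
  [ffun T => v (tabloid_act T s)].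

Lemma perm_module_act_basis s T :
  perm_module_act s (tabloid_basis T) = tabloid_basis (tabloid_act T (s^-1)%g).
Proof.
apply/ffunP=> U; rewrite !ffunE; congr (_ %:R); congr nat_of_bool.
by apply/eqP/eqP=> [<-|->]; rewrite -tabloid_actM ?mulgV ?mulVg tabloid_act1.
Qed.

Definition column_stabilizer (t : tableau) : {set 'S_n} :=
  [set s : 'S_n | [forall a, forall b,
     (s (val t a) == val t b) ==> (node_col a == node_col b)]].

Definition polytabloid (t : tableau) : perm_module :=
  \sum_(s in column_stabilizer t)
     tabloid_basis (tabloid_of (tableau_act t s)) *~ (-1) ^+ (s : bool).

(* The integral span of the polytabloids is closed under the group action     *)
(* (lemma is_specht_act), hence is the submodule they generate.               *)
Definition is_specht : pred perm_module :=
  fun v => `[< exists c : tableau -> int, v = \sum_t polytabloid t *~ c t >].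

Lemma is_specht_zmod : zmod_closed is_specht.
Proof.
split=> [|u v]; rewrite !unfold_in.
  by apply/asboolP; exists (fun=> 0); rewrite big1.
move=> /asboolP[c ->] /asboolP[d ->]; apply/asboolP; exists (fun t => c t - d t).
by rewrite -sumrB; apply: eq_bigr => t _; rewrite mulrzBr.
Qed.

HB.instance Definition _ :=
  GRing.isZmodClosed.Build perm_module is_specht is_specht_zmod.

Lemma perm_module_actD s : {morph perm_module_act s : u v / u + v}.
Proof. by move=> u v; apply/ffunP=> T; rewrite !ffunE. Qed.

Lemma perm_module_act0 s : perm_module_act s 0 = 0.
Proof. by apply/ffunP=> T; rewrite !ffunE. Qed.

Lemma perm_module_actN s : {morph perm_module_act s : u / - u}.
Proof. by move=> u; apply/ffunP=> T; rewrite !ffunE. Qed.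

Lemma perm_module_actMz s u m : perm_module_act s (u *~ m) = perm_module_act s u *~ m.
Proof.
have actMn k : perm_module_act s (u *+ k) = perm_module_act s u *+ k.
  by elim: k => [|k IHk]; rewrite ?mulr0n ?perm_module_act0 // !mulrS perm_module_actD IHk.
by case: m => k; rewrite -?pmulrn ?NegzE ?mulrNz -?pmulrn ?perm_module_actN actMn.
Qed.

Lemma perm_module_act_sum s (I : finType) (P : pred I) (F : I -> perm_module) :
  perm_module_act s (\sum_(j | P j) F j) = \sum_(j | P j) perm_module_act s (F j).
Proof. exact: (big_morph _ (perm_module_actD s) (perm_module_act0 s)). Qed.

Lemma polytabloid_act s t :
  perm_module_act s (polytabloid t) = polytabloid (tableau_act t (s^-1)%g).
Proof.
rewrite /polytabloid perm_module_act_sum.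
rewrite [RHS](reindex_inj (conjg_inj (s^-1)%g)) /=.
apply: eq_big => [x|x _].
  rewrite !inE; apply: eq_forallb => a; apply: eq_forallb => b.
  by rewrite /= !ffunE permJ (inj_eq perm_inj).
have -> : tableau_act (tableau_act t (s^-1)%g) (x ^ s^-1)%g
          = tableau_act (tableau_act t x) (s^-1)%g.
  by rewrite -!tableau_actM conjgE invgK mulKg.
by rewrite perm_module_actMz perm_module_act_basis tabloid_act_of odd_permJ.
Qed.

Lemma is_specht_act s v : is_specht v -> is_specht (perm_module_act s v).
Proof.
move=> /asboolP[c ->]; apply/asboolP; exists (fun t => c (tableau_act t s)).
rewrite perm_module_act_sum.
have act_inj : injective (tableau_act ^~ s).
  by apply: (can_inj (g := tableau_act ^~ (s^-1)%g)) => t; rewrite -tableau_actM mulgV tableau_act1.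
rewrite (reindex_inj act_inj); apply: eq_bigr => t _.
by rewrite perm_module_actMz polytabloid_act -tableau_actM mulgV tableau_act1.
Qed.

Record specht := Specht { specht_val : perm_module; _ : is_specht specht_val }.

HB.instance Definition _ := [isSub for specht_val].
HB.instance Definition _ := [Choice of specht by <:].
HB.instance Definition _ := [SubChoice_isSubZmodule of specht by <:].

Lemma specht_act_subproof s (v : specht) : is_specht (perm_module_act s (val v)).
Proof. by apply: is_specht_act; case: v. Qed.

Definition specht_act (s : 'S_n) (v : specht) : specht :=
  Specht (specht_act_subproof s v).

Lemma specht_actD s : {morph specht_act s : u v / u + v}.
Proof. by move=> u v; apply/val_inj; rewrite /= perm_module_actD. Qed.

Lemma specht_act1 v : specht_act 1%g v = v.
Proof. by apply/val_inj/ffunP=> T; rewrite /= ffunE tabloid_act1. Qed.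

Lemma specht_actM s s' v : specht_act (s * s')%g v = specht_act s (specht_act s' v).
Proof. by apply/val_inj/ffunP=> T; rewrite /= !ffunE tabloid_actM. Qed.

Definition specht_module : gmodule (perm_of 'I_n) :=
  GModule specht_actD specht_act1 specht_actM.

End Specht.

Definition specht_cohomology (i n : nat) (la : seq nat) : zmodType :=
  cohomology (specht_module n la) i.

Definition Cset (p i : nat) : set (seq nat) :=
  fun la => exists2 n, part_of n la & dvd_order p (specht_cohomology i n la).

(* Main.v *)
From HB Require Import structures.
From mathcomp Require Import all_boot all_order all_algebra.
From mathcomp Require Import fingroup perm cyclic pgroup finalg generic_quotient.
From mathcomp Require Import boolp classical_sets cardinality zify.
Require Import Defs.

(** The theorem follows from the branching rules for integral Specht modules.
    For a shape l of n, the module induced from S^l to the symmetric group on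
    n + 1 letters has a filtration with quotients the S^mu for mu in l+, and the
    restriction of S^l to n - 1 letters has one with quotients the S^mu for mu
    in l-. In positive degree the p-primary part of cohomology is half exact
    ([htors_devissage]), so if it is nonzero on a filtered module then it is
    nonzero on one of the quotients ([htors_filtered]). For (a), cohomology
    classes of S^l give classes of the induced module by Shapiro's lemma
    ([htors_coind]); for (b), restriction to a subgroup of index prime to p is
    injective on p-primary parts by transfer ([htors_res]).

    The filtrations are obtained without a basis of S^l. A tabloid is a word
    listing the row of each letter, so all modules for n letters lie in one
    tensor power. Restriction is filtered by the maps that contract the last
    letter with row r, for the removable rows r from the bottom up; induction
    by the maps that adjoin a letter in row r, for the addable rows r from the
    top down. In both cases explicit vectors, killed by all earlier maps, are
    sent to the polytabloids of the new shape ([contract_generated],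
    [adjoin_generated]). Hence the dimensions d(mu) over mu in l- add up to at
    most d(l), and those over mu in l+ to at most (n + 1) d(l).

    These inequalities are equalities. By induction on n, adding and then
    removing a node in all ways gives
      sum over mu in l+ of sum over nu in mu- of d(nu)
        = d(l) + sum over k in l- of sum over nu in k+ of d(nu)
        = d(l) + sum over k in l- of n d(k) = (n + 1) d(l),
    where the first step is the commutation relation of Young's lattice
    ([add_rem_nodeC]), while the left-hand side is at most the sum of the d(mu)
    over l+, which is at most (n + 1) d(l) ([branching_eq]). So the quotients of
    the rational filtrations are exactly the rational Specht modules and the
    last kernel is 0. For the lattices one also needs that S^mu is saturated,
    that is, contains every vector with integral entries of its rational span;
    this follows by induction along the restriction filtration
    ([filtered_saturated], [saturatedP]).

    Saturation also shows that the cohomology groups are finite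
    ([finite_specht_cohomology]), so that p divides their order exactly when
    they have nonzero p-torsion. Cohomology is computed with homogeneous
    cochains on sequences of group elements, on which the homotopies that are
    needed have short recursive definitions. *)

Set Implicit Arguments.
Unset Strict Implicit.
Unset Printing Implicit Defensive.

Import GRing.Theory Num.Theory.
Local Open Scope ring_scope.

(** * Subtraction-preserving maps and subgroups *)

Section AdditiveMap.
Variables (M N : zmodType) (phi : M -> N).
Hypothesis phiB : {morph phi : u v / u - v}.

Lemma morphB_0 : phi 0 = 0.
Proof. by have := phiB 0 0; rewrite !subrr. Qed.

Lemma morphB_N : {morph phi : u / - u}.
Proof. by move=> u; rewrite -[- u]add0r phiB morphB_0 add0r. Qed.

Lemma morphB_D : {morph phi : u v / u + v}.
Proof. by move=> u v; rewrite -{1}[v]opprK phiB morphB_N opprK. Qed.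

Lemma morphB_Mn m : {morph phi : u / u *+ m}.
Proof.
by move=> u; elim: m => [|m IHm]; rewrite ?mulr0n ?morphB_0 // !mulrS morphB_D IHm.
Qed.

Lemma morphB_Mz (m : int) : {morph phi : u / u *~ m}.
Proof.
move=> u; case: m => m; first exact: (morphB_Mn m u).
by rewrite NegzE !mulrNz morphB_N; congr (- _); apply: (morphB_Mn m.+1 u).
Qed.

End AdditiveMap.

Section Subgroup.
Variables (M : zmodType) (P : M -> Prop).
Hypotheses (P0 : P 0) (PB : forall u v, P u -> P v -> P (u - v)).

Lemma subgroupN u : P u -> P (- u).
Proof. by move=> Pu; rewrite -sub0r; apply: PB. Qed.

Lemma subgroupD u v : P u -> P v -> P (u + v).
Proof. by move=> Pu /subgroupN Pv; rewrite -[v]opprK; apply: PB. Qed.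

Lemma subgroupMn m u : P u -> P (u *+ m).
Proof.
move=> Pu; elim: m => [|m IHm]; first by rewrite mulr0n.
by rewrite mulrS; apply: subgroupD.
Qed.

Lemma subgroupMz (m : int) u : P u -> P (u *~ m).
Proof.
by move=> Pu; case: m => k; rewrite ?NegzE ?mulrNz;
  [|apply: subgroupN]; apply: subgroupMn.
Qed.

Lemma subgroup_sum (I : finType) (A : pred I) (F : I -> M) :
  (forall j, A j -> P (F j)) -> P (\sum_(j | A j) F j).
Proof. by move=> PF; apply: big_ind => //; apply: subgroupD. Qed.

End Subgroup.

(** * Homogeneous cochains *)

(** The alternating sum of the faces of a simplex, split off at its first vertex:
    the identities for [hd] and [prism] become inductions on that vertex. *)
Fixpoint hd (T : Type) (M : zmodType) (c : seq T -> M) (s : seq T) : M :=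
  if s is x :: s' then c s' - hd (c \o cons x) s' else 0.

Section Differential.
Variables (T : Type) (M : zmodType).
Implicit Types (c b : seq T -> M) (s : seq T).

Lemma eq_hd k c b s : (forall u, size u = k -> c u = b u) ->
  size s = k.+1 -> hd c s = hd b s.
Proof.
elim: s k c b => [|x s IHs] k c b //= cb [sk]; rewrite cb //.
case: k => [|k] in cb sk *; first by case: s sk {IHs}.
by rewrite (IHs k _ (b \o cons x)) // => u uk; apply: cb; rewrite /= uk.
Qed.

Lemma raddf_hd (N : zmodType) (phi : M -> N) c s :
  {morph phi : x y / x - y} -> hd (phi \o c) s = phi (hd c s).
Proof.
move=> phiB; have phi0 := morphB_0 phiB.
elim: s c => [|x s IHs] c //=; rewrite phiB -IHs; congr (_ - _).
Qed.

Lemma hdB c b s : hd (fun u => c u - b u) s = hd c s - hd b s.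
Proof.
elim: s c b => [|x s IHs] c b /=; first by rewrite subrr.
have -> : (fun u => c u - b u) \o cons x
          = (fun u => (c \o cons x) u - (b \o cons x) u) by [].
by rewrite IHs !opprD !opprK addrACA.
Qed.

Lemma hd0 s : hd (fun=> 0 : M) s = 0.
Proof. by elim: s => //= x s IHs; rewrite -[hd _ s]/(hd (fun=> 0) s) IHs subrr. Qed.

Lemma hd_sum (I : finType) (F : I -> seq T -> M) s :
  hd (fun u => \sum_j F j u) s = \sum_j hd (F j) s.
Proof.
elim: s F => [|x s IHs] F /=; first by rewrite big1.
rewrite sumrB; congr (_ - _); exact: (IHs (fun j => F j \o cons x)).
Qed.

Lemma hd_map (U : Type) (k : U -> T) c (u : seq U) : hd c (map k u) = hd (c \o map k) u.
Proof. by elim: u c => [|x s IHs] c //=; rewrite IHs. Qed.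

Lemma hd_hd c s : hd (hd c) s = 0.
Proof.
elim: s c => [|x s IHs] c //=.
have -> : hd c \o cons x = fun u => c u - hd (c \o cons x) u by [].
by rewrite hdB IHs subr0 subrr.
Qed.

(** The prism operator: the alternating sum over the positions j of the value of
    [c] at [s_0, ..., s_j, k s_j, k s_(j+1), ...]. *)
Fixpoint prism (k : T -> T) c s : M :=
  if s is x :: s' then c (x :: k x :: map k s') - prism k (c \o cons x) s'
  else 0.

Lemma prism_eq0 n k c s : (forall u, size u = n.+1 -> c u = 0) ->
  size s = n -> prism k c s = 0.
Proof.
elim: s n c => [|x s IHs] [|n] c //= c0 [sn].
rewrite c0 /= ?size_map ?sn // (IHs n) ?subrr // => u un.
by rewrite /= c0 //= un.
Qed.

Lemma prismB k c b s : prism k (fun u => c u - b u) s = prism k c s - prism k b s.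
Proof.
elim: s c b => [|x s IHs] c b /=; first by rewrite subrr.
have -> : (fun u => c u - b u) \o cons x
          = (fun u => (c \o cons x) u - (b \o cons x) u) by [].
by rewrite IHs !opprD !opprK addrACA.
Qed.

(** The two ends of the prism over a simplex are the simplex and its image; its
    sides cancel against the prism of the boundary. *)
Lemma prism_homotopy k c s :
  hd (prism k c) s + prism k (hd c) s = c (map k s) - c s.
Proof.
elim: s c => [|x s IHs] c /=; first by rewrite addr0 subrr.
have -> : prism k c \o cons x = fun u =>
    (c \o cons x \o cons (k x) \o map k) u - prism k (c \o cons x) u by [].
have -> : hd c \o cons x = fun u => c u - hd (c \o cons x) u by [].
have /= := IHs (c \o cons x).
rewrite hdB prismB -(hd_map k (c \o cons x \o cons (k x)) s) /=.
move: (hd _ (map k s)) (hd _ s) (prism k c s) (prism _ _ s) => h A q B AB.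
(* The terms [q] and [h] cancel, and so do the two ends of the inner prism. *)
rewrite !opprD !opprK !addrA (ACl ((1*7)*(2*6)*4*5*(3*8)))%AC /=.
by rewrite subrr addNr !add0r AB addrA addrNK.
Qed.

End Differential.

Section Action.
Variables (G : finGroupType) (M : gmodule G).

Lemma gact0 (g : G) : gact g (0 : M) = 0.
Proof. by apply: (addrI (gact g 0)); rewrite -gactD !addr0. Qed.

Lemma gactN (g : G) : {morph @gact G M g : u / - u}.
Proof. by move=> u; apply/eqP; rewrite -addr_eq0 -gactD addNr gact0. Qed.

Lemma gactB (g : G) : {morph @gact G M g : u v / u - v}.
Proof. by move=> u v; rewrite gactD gactN. Qed.

Lemma gactMn (g : G) m : {morph @gact G M g : u / u *+ m}.
Proof.
by move=> u; elim: m => [|m IHm]; rewrite ?mulr0n ?gact0 // !mulrS gactD IHm.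
Qed.

Lemma gact_sum (g : G) (I : finType) (P : pred I) (F : I -> M) :
  gact g (\sum_(j | P j) F j) = \sum_(j | P j) gact g (F j).
Proof. exact: (big_morph _ (gactD g) (gact0 g)). Qed.

Lemma gactK (g : G) : cancel (@gact G M g) (gact g^-1%g).
Proof. by move=> u; rewrite -gactM mulVg gact1. Qed.

Lemma gactVK (g : G) : cancel (@gact G M g^-1%g) (gact g).
Proof. by move=> u; rewrite -gactM mulgV gact1. Qed.

End Action.

Definition mshift (G : finGroupType) (g : G) : seq G -> seq G := map (mulg g).

Lemma mshiftM (G : finGroupType) (g h : G) s : mshift (g * h)%g s = mshift g (mshift h s).
Proof. by rewrite /mshift -map_comp; apply: eq_map => x; rewrite /= mulgA. Qed.

Lemma mshift1 (G : finGroupType) (s : seq G) : mshift 1%g s = s.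
Proof. by rewrite /mshift -[RHS]map_id; apply: eq_map => x; rewrite mul1g. Qed.

Definition substable (G : finGroupType) (M : gmodule G) (L : M -> Prop) :=
  [/\ L 0, forall u v, L u -> L v -> L (u - v) & forall g u, L u -> L (gact g u)].

Section Torsion.
Variables (G : finGroupType) (M : gmodule G).
Implicit Types (L : M -> Prop) (c b : seq G -> M).

(** Homogeneous cochains in k variables with values in a submodule [L] of [M].
    The conditions are restricted to sequences of the relevant size, so that
    cochains of all degrees have the same type. Keeping [L] as a predicate makes
    the kernels of a filtration available without new module structures. *)
Definition hcochain L k c := forall s, size s = k ->
  L (c s) /\ forall g, c (mshift g s) = gact g (c s).

Definition hcob L i c :=
  exists2 b, hcochain L i b & forall s, size s = i.+1 -> c s = hd b s.

Definition hcocycle L i c :=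
  hcochain L i.+1 c /\ forall s, size s = i.+2 -> hd c s = 0.

(** For positive [i] and prime [p], this says that the p-primary part of the i-th
    cohomology group of [L] is nonzero. *)
Definition htors p i L := exists c,
  [/\ hcocycle L i c, ~ hcob L i c & exists a, hcob L i (fun s => c s *+ p ^ a)].

Section Stable.
Variables (L : M -> Prop) (Lst : substable L).

Let L0 : L 0. Proof. by case: Lst. Qed.

Let LB u v : L u -> L v -> L (u - v).
Proof. by case: Lst => _ + _; apply. Qed.

Lemma hcochainB k c b : hcochain L k c -> hcochain L k b ->
  hcochain L k (fun s => c s - b s).
Proof.
move=> Lc Lb s sk; have [Lcs cG] := Lc s sk; have [Lbs bG] := Lb s sk.
by split=> [|g]; [exact: LB | rewrite cG bG gactB].
Qed.

Lemma hcochainMn m k c : hcochain L k c -> hcochain L k (fun s => c s *+ m).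
Proof.
move=> Lc s sk; have [Lcs cG] := Lc s sk.
by split=> [|g]; [exact: (subgroupMn L0 LB) | rewrite cG gactMn].
Qed.

Lemma stable_hd k (c : seq G -> M) s : (forall u, size u = k -> L (c u)) ->
  size s = k.+1 -> L (hd c s).
Proof.
elim: s k c => [|x s IHs] k c //= Lc [sk].
apply: LB; first exact: Lc.
case: k => [|k] in Lc sk *; first by case: s sk {IHs}.
by apply: (IHs k) => // u uk; apply: Lc; rewrite /= uk.
Qed.

Lemma hd_equiv k (c : seq G -> M) g s :
  (forall u, size u = k -> c (mshift g u) = gact g (c u)) ->
  size s = k.+1 -> hd c (mshift g s) = gact g (hd c s).
Proof.
move=> cG sk; rewrite hd_map -(raddf_hd _ _ (gactB g)).
exact: (eq_hd (k := k)).
Qed.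

Lemma hcochain_hd k c : hcochain L k c -> hcochain L k.+1 (hd c).
Proof.
move=> Lc s sk; split=> [|g]; first by apply: stable_hd sk => u /Lc[].
by apply: hd_equiv sk => u /Lc[].
Qed.

Lemma hcobB i c b : hcob L i c -> hcob L i b -> hcob L i (fun s => c s - b s).
Proof.
move=> [c' Lc' cE] [b' Lb' bE]; exists (fun s => c' s - b' s).
  exact: hcochainB.
by move=> s si; rewrite hdB cE ?bE.
Qed.

Lemma hcobD i c b : hcob L i c -> hcob L i b -> hcob L i (fun s => c s + b s).
Proof.
move=> cb bb; have nb := hcobB (hcobB bb bb) bb.
by have [a La aE] := hcobB cb nb; exists a => // s /aE <-; rewrite subrr sub0r opprK.
Qed.

Lemma hdMn m c s : hd (fun u => c u *+ m) s = hd c s *+ m.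
Proof. by rewrite -(raddf_hd (phi := fun u => u *+ m)) // => u v; rewrite mulrnBl. Qed.

Lemma hcobMn m i c : hcob L i c -> hcob L i (fun s => c s *+ m).
Proof.
move=> [b Lb cE]; exists (fun s => b s *+ m); first exact: hcochainMn.
by move=> s si; rewrite hdMn cE.
Qed.

Lemma hcob_coprime i c m n : (0 < m)%N -> coprime m n ->
  hcob L i (fun s => c s *+ m) -> hcob L i (fun s => c s *+ n) -> hcob L i c.
Proof.
move=> m_gt0 /(coprimeP _ m_gt0)[[u v] /= uv] cm cn.
have [b Lb bE] := hcobB (hcobMn u cm) (hcobMn v cn).
exists b => // s si; rewrite -bE // -!mulrnA [(m * u)%N]mulnC [(n * v)%N]mulnC.
by rewrite -mulrnBr ?uv // ltnW // -subn_gt0 uv.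
Qed.

(** The sum over the first variable is a contracting homotopy up to the factor
    #|G|: the first face of [g :: s] is [s], and the others have first
    variable [g]. *)
Lemma hcob_card i c : hcocycle L i c -> hcob L i (fun s => c s *+ #|G|).
Proof.
move=> [Lc dc]; exists (fun s => \sum_g c (g :: s)).
  move=> s si; split=> [|h].
    by apply: (subgroup_sum L0 LB) => g _; apply: (proj1 (Lc _ _)); rewrite /= si.
  rewrite gact_sum (reindex_inj (mulgI h)); apply: eq_bigr => g _.
  by rewrite -(proj2 (Lc (g :: s) _)) //= si.
move=> s si; rewrite (hd_sum (fun g s => c (g :: s))) -sumr_const.
apply: eq_bigr => g _; have /eqP := dc (g :: s) (congr1 S si).
by rewrite /= subr_eq0 => /eqP.
Qed.

End Stable.
End Torsion.

(** * Change of coefficients *)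

Section Coefficients.
Variables (G : finGroupType) (M N : gmodule G) (phi : M -> N).
Hypotheses (phiB : {morph phi : u v / u - v})
  (phiG : forall g u, phi (gact g u) = gact g (phi u)).
Variables (L : M -> Prop) (K : N -> Prop).
Hypothesis Lst : substable L.
Hypothesis LK : forall u, L u -> K (phi u).
Hypothesis KL : forall v, K v -> exists2 u, L u & phi u = v.

Lemma hcochain_comp k c : hcochain L k c -> hcochain K k (phi \o c).
Proof.
move=> Lc s sk; have [Lcs cG] := Lc s sk.
by split=> [|g] /=; [exact: LK | rewrite cG phiG].
Qed.

(** The diagonal action on non-empty sequences is free: a lift is chosen on the
    sequences that start with 1 and transported along orbits. *)
Lemma hcochain_lift k b : hcochain K k.+1 b ->
  exists2 c, hcochain L k.+1 c & forall s, size s = k.+1 -> phi (c s) = b s.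
Proof.
move=> Kb; have [f fP] : exists f, forall v, K v -> L (f v) /\ phi (f v) = v.
  have /choice[f fP] : forall v, exists u, K v -> L u /\ phi u = v.
    move=> v; have [Kv|nKv] := pselect (K v); last by exists 0.
    by have [u Lu uv] := KL Kv; exists u.
  by exists f.
pose c s := if s is x :: _ then gact x (f (b (mshift x^-1%g s))) else 0.
have cP x s : size (x :: s) = k.+1 -> L (f (b (mshift x^-1%g (x :: s)))) /\
    phi (f (b (mshift x^-1%g (x :: s)))) = b (mshift x^-1%g (x :: s)).
  by move=> sk; apply: fP; apply: (proj1 (Kb _ _)); rewrite size_map.
exists c => [[|x s] // sk | [|x s] // sk].
  split=> [|g]; first by case: Lst => _ _; apply; case: (cP x s sk).
  rewrite -[LHS]/(gact (g * x)%g (f (b (mshift (g * x)^-1%g (mshift g (x :: s)))))).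
  by rewrite gactM invMg mshiftM -[mshift _ (mshift g _)]mshiftM mulVg mshift1.
by rewrite phiG (proj2 (cP x s sk)) (proj2 (Kb _ sk)) gactVK.
Qed.

Lemma ker_stable : substable (fun u => L u /\ phi u = 0).
Proof.
have phi0 := morphB_0 phiB.
have [L0 LB LG] := Lst; split=> [|u v [Lu u0] [Lv v0]|g u [Lu u0]] //.
  by split; [exact: LB | rewrite phiB u0 v0 subrr].
by split; [exact: LG | rewrite phiG u0 gact0].
Qed.

Lemma hcob_sub (L' : M -> Prop) i c :
  (forall u, L' u -> L u) -> hcob L' i c -> hcob L i c.
Proof.
move=> L'L [b Lb bE]; exists b => // s si; have [/L'L ? ?] := Lb s si.
by split.
Qed.

(** Half-exactness in the middle, for the p-primary part. If the image of a
    class x of p-power order vanishes, then x comes from the kernel of [phi];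
    a preimage need not have p-power order, but it is killed by |G|, and the
    p'-part of |G| acts invertibly on x. *)
Lemma htors_devissage p i : prime p -> (0 < i)%N -> htors p i L ->
  htors p i (fun u => L u /\ phi u = 0) \/ htors p i K.
Proof.
move=> p_pr; case: i => // i _ [c [[Lc dc] nc [a ca]]].
have [[b Kb bE]|nK] := pselect (hcob K i.+1 (phi \o c)); last first.
  right; exists (phi \o c); split=> //.
    split=> [|s si]; first exact: hcochain_comp.
    by rewrite raddf_hd // dc // morphB_0.
  have [b Lb bE] := ca; exists a; exists (phi \o b); first exact: hcochain_comp.
  move=> s si; rewrite raddf_hd // -bE //=.
  by rewrite morphB_Mn.
left; have [b' Lb' b'E] := hcochain_lift Kb.
pose m := (#|G| `_ p^')%N; pose c' s := c s - hd b' s.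
have Kst' := ker_stable.
have c'P : hcocycle (fun u => L u /\ phi u = 0) i.+1 c'.
  split=> s si; last by rewrite hdB dc // hd_hd subrr.
  have [Lcs csG] := hcochainB Lst Lc (hcochain_hd Lst Lb') si.
  split=> //; split=> //; rewrite phiB -[phi (c s)]/((phi \o c) s) bE // -(raddf_hd _ _ phiB).
  by rewrite (eq_hd (k := i.+1) b'E) ?subrr.
have c'c : hcob L i.+1 (fun s => c s - c' s).
  by exists b' => // s si; rewrite /c' subKr.
have cE n : hcob L i.+1 (fun s => c' s *+ n) -> hcob L i.+1 (fun s => c s *+ n).
  move=> c'n; have [b1 Lb1 b1E] := hcobD Lst c'n (hcobMn Lst n c'c).
  by exists b1 => // s si; rewrite -b1E // -mulrnDl addrC subrK.
have pa_m : coprime (p ^ a) m.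
  by rewrite coprimeXl // prime_coprime // -p'natE // /m part_pnat.
have pa_gt0 : (0 < p ^ a)%N by rewrite expn_gt0 prime_gt0.
exists (fun s => c' s *+ m); split.
- split=> [|s si]; first exact: (hcochainMn Kst') (proj1 c'P).
  by rewrite hdMn (proj2 c'P) // mul0rn.
- move=> c'm; apply: nc; apply: (hcob_coprime Lst pa_gt0 pa_m ca).
  by apply: cE; apply: hcob_sub c'm => u [].
exists (logn p #|G|); have [b1 Lb1 b1E] := hcob_card Kst' c'P.
exists b1 => // s si; rewrite -b1E // -mulrnA mulnC -p_part partnC //.
by rewrite -cardsT cardG_gt0.
Qed.

End Coefficients.

Section Isomorphism.
Variables (G : finGroupType) (M N : gmodule G) (phi : M -> N).
Hypotheses (phiB : {morph phi : u v / u - v})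
  (phiG : forall g u, phi (gact g u) = gact g (phi u)).
Variables (L : M -> Prop) (K : N -> Prop).
Hypothesis Lst : substable L.
Hypothesis LK : forall u, L u -> K (phi u).
Hypothesis KL : forall v, K v -> exists2 u, L u & phi u = v.
Hypothesis phiI : forall u, L u -> phi u = 0 -> u = 0.

Let phi_inj u v : L u -> L v -> phi u = phi v -> u = v.
Proof.
move=> Lu Lv uv; apply/eqP; rewrite -subr_eq0; apply/eqP; apply: phiI.
  by case: Lst => _ + _; apply.
by rewrite phiB uv subrr.
Qed.

Let hcob_iso i c : (0 < i)%N -> hcochain L i.+1 c -> hcob K i (phi \o c) -> hcob L i c.
Proof.
case: i => // i _ Lc [b Kb bE].
have [b' Lb' b'E] := hcochain_lift phiG Lst KL Kb.
exists b' => // s si; apply: phi_inj; first by case: (Lc s si).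
  by apply: stable_hd si => // u /Lb'[].
by rewrite -(raddf_hd _ _ phiB) (eq_hd (k := i.+1) b'E) // -bE.
Qed.

Let hcob_comp i c : hcob L i c -> hcob K i (phi \o c).
Proof.
move=> [b Lb bE]; exists (phi \o b); first exact: (hcochain_comp phiG LK).
by move=> s si; rewrite /= bE // raddf_hd.
Qed.

Lemma htors_iso p i : (0 < i)%N -> htors p i L <-> htors p i K.
Proof.
move=> i0; split=> [[c [[Lc dc] nc [a ca]]]|[c [[Kc dc] nc [a ca]]]].
  exists (phi \o c); split.
  - split=> [|s si]; first exact: (hcochain_comp phiG LK).
    by rewrite raddf_hd // dc // morphB_0.
  - by move=> /(hcob_iso i0 Lc).
  exists a; have [b Kb bE] := hcob_comp ca.
  by exists b => // s si; rewrite -bE //= morphB_Mn.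
have [c' Lc' c'E] := hcochain_lift phiG Lst KL Kc.
exists c'; split.
- split=> // s si; apply: phiI; first by apply: stable_hd si => // u /Lc'[].
  by rewrite -(raddf_hd _ _ phiB) (eq_hd (k := i.+1) c'E) // dc.
- move=> /hcob_comp[b Kb bE]; apply: nc; exists b => // s si.
  by rewrite -bE //= c'E.
exists a; apply: (hcob_iso i0); first exact: hcochainMn.
have [b Kb bE] := ca; exists b => // s si; rewrite -bE //=.
by rewrite morphB_Mn // c'E.
Qed.

End Isomorphism.

(** * Restriction, coinduction and transfer *)

Section Subgroup.

(* [iota] embeds the subgroup, [rep] chooses representatives of its right cosets,
   [pt x] is the coset of [x] and [kappa x] its component in the subgroup. *)
Variables (G H : finGroupType) (I : finType).
Variables (iota : H -> G) (kappa : G -> H) (pt : G -> I) (rep : I -> G).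
Hypotheses (iotaM : {morph iota : h k / (h * k)%g})
  (kappaM : forall h x, kappa (iota h * x)%g = (h * kappa x)%g)
  (kappa1 : kappa 1%g = 1%g)
  (ptM : forall h x, pt (iota h * x)%g = pt x)
  (ptK : cancel rep pt)
  (repE : forall x, x = (iota (kappa x) * rep (pt x))%g).

Let iota1 : iota 1%g = 1%g.
Proof. by apply: (mulgI (iota 1)); rewrite -iotaM !mulg1. Qed.

Let iotaK : cancel iota kappa.
Proof. by move=> h; rewrite -[iota h]mulg1 kappaM kappa1 mulg1. Qed.

Let kappa_rep a : kappa (rep a) = 1%g.
Proof.
apply: (can_inj iotaK); rewrite iota1; apply: (mulIg (rep a)).
by rewrite mul1g -{2}[a]ptK -repE.
Qed.

Let rep_pt1 : rep (pt 1%g) = 1%g.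
Proof. by have := repE 1; rewrite kappa1 iota1 mul1g. Qed.

Let map_iota h s : map iota (mshift h s) = mshift (iota h) (map iota s).
Proof. by rewrite /mshift -!map_comp; apply: eq_map => x /=; rewrite iotaM. Qed.

Let map_kappa h s : map kappa (mshift (iota h) s) = mshift h (map kappa s).
Proof. by rewrite /mshift -!map_comp; apply: eq_map => x /=; rewrite kappaM. Qed.

Let map_iotaK s : map kappa (map iota s) = s.
Proof. by rewrite mapK. Qed.

Section Restriction.
Variables (M : gmodule G).

Definition gres : gmodule H.
Proof.
refine (@GModule H M (fun h => gact (iota h)) _ _ _).
- by move=> h u v; rewrite gactD.
- by move=> u; rewrite iota1 gact1.
by move=> h k u; rewrite iotaM gactM.
Defined.

Variables (L : M -> Prop) (Lst : substable L).

Lemma substable_res : substable (L : gres -> Prop).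
Proof. by have [L0 LB LG] := Lst; split=> // h u; apply: LG. Qed.

Lemma hcochain_res k (c : seq G -> M) : hcochain L k c ->
  hcochain (L : gres -> Prop) k (c \o map iota).
Proof.
move=> Lc s sk; have [|Lcs cG] := Lc (map iota s); first by rewrite size_map.
by split=> // h; rewrite /= map_iota cG.
Qed.

Lemma stable_prism k n (c : seq G -> M) s : (forall u, size u = n.+1 -> L (c u)) ->
  size s = n -> L (prism k c s).
Proof.
have [L0 LB _] := Lst.
elim: s n c => [|x s IHs] [|n] c //= Lc [sn]; apply: LB.
  by apply: Lc; rewrite /= size_map sn.
by apply: (IHs n) => // u un; apply: Lc; rewrite /= un.
Qed.

Lemma prism_equiv (k : G -> G) g n (c : seq G -> M) s :
  (forall x, k (g * x)%g = (g * k x)%g) ->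
  (forall u, size u = n.+1 -> c (mshift g u) = gact g (c u)) ->
  size s = n -> prism k c (mshift g s) = gact g (prism k c s).
Proof.
move=> kg cg sn.
suff E (d : seq G -> M) : (forall u, size u = n.+1 -> d (mshift g u) = gact g (c u)) ->
    prism k d (mshift g s) = gact g (prism k c s) by exact: E.
move: cg => _.
elim: s n c d sn => [|x s IHs] [|n] c d //= sn dc; first by rewrite gact0.
case: sn => sn.
rewrite gactB (IHs n (c \o cons x)) //; last by move=> u un; rewrite -dc //= un.
have kgs : map k (mshift g s) = mshift g (map k s).
  by rewrite /mshift -!map_comp; apply: eq_map => y /=.
by congr (_ - _); rewrite -dc /= ?size_map ?sn // -/(mshift g s) kgs kg.
Qed.

(** Transfer. By the prism operator, [c] is homotopic to its pull-back along
    [iota \o kappa], which only involves the restriction of [c] to the subgroup.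
    If that restriction bounds, then [c] is the boundary of a cochain [b0] that
    is equivariant only for the subgroup; summing the conjugates of [b0] over
    the cosets gives an equivariant cochain with boundary [c *+ #|I|]. *)
Lemma htors_res p i : prime p -> ~~ (p %| #|I|)%N ->
  htors p i L -> htors p i (L : gres -> Prop).
Proof.
move=> p_pr pI [c [[Lc dc] nc [a ca]]].
exists (c \o map iota); split.
- split=> [|s si]; first exact: hcochain_res.
  by rewrite -hd_map dc // size_map.
- case=> u Lu uE; apply: nc.
  pose k := iota \o kappa; pose b0 s := u (map kappa s) - prism k c s.
  have b0E s : size s = i.+1 -> hd b0 s = c s.
    move=> si; have /eqP := prism_homotopy k c s.
    rewrite (prism_eq0 k dc si) addr0 => /eqP pE.
    rewrite hdB pE -(hd_map kappa u) -uE ?size_map //= -map_comp.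
    by rewrite opprB addrC subrK.
  have b0L s : size s = i -> L (b0 s).
    move=> si; have [_ LB _] := Lst; apply: LB.
      by apply: (proj1 (Lu _ _)); rewrite size_map.
    by apply: stable_prism si => v /Lc[].
  have b0H h s : size s = i -> b0 (mshift (iota h) s) = gact (iota h) (b0 s).
    move=> si; rewrite /b0 gactB map_kappa (proj2 (Lu _ _)) ?size_map //.
    congr (_ - _); apply: prism_equiv si => [x|v /Lc[] //].
    by rewrite /k /= kappaM iotaM.
  pose B s x := gact x^-1%g (b0 (mshift x s)).
  have BE s x : size s = i -> B s x = B s (rep (pt x)).
    move=> si; rewrite /B {1 2}(repE x) mshiftM b0H ?size_map // -gactM.
    by rewrite invMg mulgKV.
  pose b s := \sum_j B s (rep j).
  have bE : hcob L i (fun s => c s *+ #|I|).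
    exists b => s si; last first.
      rewrite (hd_sum (fun j s => B s (rep j))) -sumr_const; apply: eq_bigr => j _.
      have -> : (fun s => B s (rep j))
              = gact (rep j)^-1%g \o (b0 \o mshift (rep j)) by [].
      rewrite raddf_hd; last exact: gactB.
      rewrite -hd_map b0E ?size_map // -/(mshift _ _).
      by rewrite (proj2 (Lc s si)) gactK.
    split=> [|g].
      have [L0 LB LG] := Lst; apply: (subgroup_sum L0 LB) => j _; apply: LG.
      by apply: b0L; rewrite size_map.
    rewrite /b (reindex (fun j => pt (rep j * g^-1)%g)) /=; last first.
      exists (fun j => pt (rep j * g)%g) => j _.
        by rewrite -{2}[j]ptK -[in RHS](mulgKV g (rep j)) {2}(repE (rep j * g^-1)%g) -mulgA ptM.
      by rewrite -{2}[j]ptK -[in RHS](mulgK g (rep j)) {2}(repE (rep j * g)%g) -mulgA ptM.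
    rewrite gact_sum; apply: eq_bigr => j _; rewrite -BE ?size_map //.
    by rewrite /B -mshiftM mulgKV -gactM invMg invgK.
  have pa_gt0 : (0 < p ^ a)%N by rewrite expn_gt0 prime_gt0.
  apply: (hcob_coprime Lst pa_gt0 _ ca bE).
  by rewrite coprimeXl // prime_coprime.
exists a; have [b Lb bE] := ca; exists (b \o map iota); first exact: hcochain_res.
by move=> s si; rewrite -hd_map -bE // size_map.
Qed.

End Restriction.

Section Coinduction.
Variables (M : gmodule H).

(** The value of [psi] at [a] stands for the value at [rep a] of an H-equivariant
    function on G, on which G acts by right translation. *)
Definition coind_act (g : G) (psi : {ffun I -> M}) : {ffun I -> M} :=
  [ffun a => gact (kappa (rep a * g)%g) (psi (pt (rep a * g)%g))].

Definition coind : gmodule G.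
Proof.
refine (@GModule G {ffun I -> M} coind_act _ _ _).
- by move=> g u v; apply/ffunP=> a; rewrite !ffunE gactD.
- by move=> u; apply/ffunP=> a; rewrite !ffunE !mulg1 kappa_rep gact1 ptK.
move=> g h u; apply/ffunP=> a; rewrite !ffunE -gactM -kappaM !mulgA -repE.
congr (gact _ (u _)); rewrite [X in pt (X * h)%g = _](repE (rep a * g)%g).
by rewrite -mulgA ptM.
Defined.

Variables (L : M -> Prop) (Lst : substable L).

Definition coind_sub (psi : coind) := forall a, L (psi a).

Lemma substable_coind : substable coind_sub.
Proof.
have [L0 LB LG] := Lst; split=> [a|u v Lu Lv a|g u Lu a]; rewrite !ffunE //.
  exact: LB.
exact: LG.
Qed.

Definition coind_cochain (c : seq H -> M) (s : seq G) : coind :=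
  [ffun a => c (map kappa (mshift (rep a) s))].

Lemma hcochain_coind k c : hcochain L k c -> hcochain coind_sub k (coind_cochain c).
Proof.
move=> Lc s sk; split=> [a|g]; first by rewrite ffunE; apply: (proj1 (Lc _ _)); rewrite !size_map.
apply/ffunP=> a; rewrite !ffunE -mshiftM {1}(repE (rep a * g)%g) mshiftM map_kappa.
by rewrite (proj2 (Lc _ _)) // !size_map.
Qed.

Lemma hd_coind c s : hd (coind_cochain c) s = coind_cochain (hd c) s.
Proof.
apply/ffunP=> a; rewrite ffunE hd_map.
have /= <- := raddf_hd (phi := fun psi : coind => psi a) (coind_cochain c) s.
  rewrite hd_map; congr (hd _ s); apply/funext=> u.
  by rewrite /= ffunE /mshift.
by move=> u v; rewrite !ffunE.
Qed.

(** The half of Shapiro's lemma that produces classes: [coind_cochain] is a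
    cochain map, and restricting to the subgroup and evaluating at the coset
    of 1 recovers the original cochain. *)
Lemma htors_coind p i : htors p i L -> htors p i coind_sub.
Proof.
move=> [c [[Lc dc] nc [a ca]]]; exists (coind_cochain c); split.
- split=> [|s si]; first exact: hcochain_coind.
  by rewrite hd_coind; apply/ffunP=> j; rewrite !ffunE dc // !size_map.
- case=> b Lb bE; apply: nc; exists (fun s => b (map iota s) (pt 1%g)).
    move=> s si; have [|Lbs bG] := Lb (map iota s); first by rewrite size_map.
    split=> // h; rewrite map_iota bG ffunE rep_pt1 mul1g iotaK.
    by rewrite -[iota h]mulg1 ptM.
  move=> s si; have := congr1 (fun psi : coind => psi (pt 1%g)) (bE (map iota s) _).
  rewrite size_map => /(_ si); rewrite ffunE rep_pt1 mshift1 map_iotaK => ->.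
  rewrite -(raddf_hd (phi := fun psi : coind => psi (pt 1%g))) ?hd_map //.
  by move=> u v; rewrite !ffunE.
exists a; have [b Lb bE] := ca; exists (coind_cochain b); first exact: hcochain_coind.
move=> s si; rewrite hd_coind; apply/ffunP=> j.
have E m (u : coind) : (u *+ m) j = u j *+ m.
  by elim: m => [|m IHm]; rewrite ?mulr0n ?ffunE // !mulrS ffunE IHm.
by rewrite E !ffunE bE // !size_map.
Qed.

End Coinduction.
End Subgroup.

(** * The bar complex *)

Definition delnth (T : Type) k (s : seq T) := take k s ++ drop k.+1 s.

Lemma nth_delnth (T : Type) (x0 : T) k (s : seq T) j : (k < size s)%N ->
  nth x0 (delnth k s) j = nth x0 s (if (j < k)%N then j else j.+1).
Proof.
move=> ks; rewrite /delnth nth_cat size_take ks.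
case: ifP => jk; first by rewrite nth_take.
by rewrite nth_drop addSn subnKC // leqNgt jk.
Qed.

Lemma hdE (T : Type) (M : zmodType) (c : seq T -> M) s :
  hd c s = \sum_(k < size s) c (delnth k s) *~ (-1) ^+ k.
Proof.
elim: s c => [|x s IHs] c /=; first by rewrite big_ord0.
rewrite big_ord_recl /= /delnth take0 drop1 /=; congr (_ + _).
rewrite IHs -sumrN; apply: eq_bigr => k _ /=.
by rewrite -mulrNz exprS mulN1r.
Qed.

Section Bar.
Variables (G : finGroupType) (M : gmodule G).

Definition quotients i (s : seq G) : {ffun 'I_i -> G} :=
  [ffun j : 'I_i => ((nth 1 s j)^-1 * nth 1 s j.+1)%g].

(** Inhomogeneous cochains are read on the edges of a simplex and homogeneous
    ones on its vertices. *)
Definition homog i (f : cochain M i) (s : seq G) : M :=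
  gact (nth 1%g s 0) (f (quotients i s)).

(** Deleting an inner vertex multiplies the two edges that meet there. *)
Lemma homog_coboundary i (f : cochain M i) s : size s = i.+2 ->
  homog (coboundary_map f) s = hd (homog f) s.
Proof.
move=> si; rewrite hdE si big_ord_recl big_ord_recr /= addrA.
rewrite /homog ffunE !gactD gact_sum -gactM; congr (_ + _ + _).
- rewrite ffunE /delnth take0 drop1 mulVKg expr0 mulr1z nth_behead; congr (gact _ (f _)).
  by apply/ffunP=> j; rewrite !ffunE /= !nth_behead.
- apply: eq_bigr => k _; rewrite morphB_Mz; last exact: gactB.
  rewrite /= /bump leq0n add1n.
  have ks : (k.+1 < size s)%N by rewrite si !ltnS ltnW.
  rewrite nth_delnth //=; congr (gact _ (f _) *~ _).
  apply/ffunP=> j; rewrite !ffunE !nth_delnth //= /bump /=.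
  rewrite [(i <= j)%N]leqNgt ltn_ord add0n !add1n !ltnS.
  have [jk|kj|/val_inj ->] := ltngtP j k.
  + by [].
  + by rewrite -val_eqE gtn_eqF.
  by rewrite eqxx -mulgA mulKVg.
rewrite morphB_Mz; last exact: gactB.
rewrite /= /bump leq0n add1n.
have is' : (i.+1 < size s)%N by rewrite si.
rewrite nth_delnth //; congr (gact _ (f _) *~ _).
apply/ffunP=> j; rewrite !ffunE !nth_delnth //= /bump /=.
by rewrite [(i <= j)%N]leqNgt !ltnS ltn_ord (ltnW (ltn_ord j)).
Qed.

Lemma homogB i (f h : cochain M i) s : homog (f - h) s = homog f s - homog h s.
Proof. by rewrite /homog !ffunE gactB. Qed.

Lemma homogMn i m (f : cochain M i) s : homog (f *+ m) s = homog f s *+ m.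
Proof. by apply: (morphB_Mn (phi := fun f : cochain M i => homog f s)) => u v; apply: homogB. Qed.

Lemma homog_shift i (f : cochain M i) g s : size s = i.+1 ->
  homog f (mshift g s) = gact g (homog f s).
Proof.
move=> si; rewrite /homog (nth_map 1%g) ?si // gactM; do 2 congr (gact _ _).
congr (f _); apply/ffunP=> j; have ji := ltn_ord j; have ji' := ltnW ji.
rewrite !ffunE !(nth_map 1%g) ?si ?ltnS //.
by rewrite invMg mulgA mulgKV.
Qed.

(** The vertices of the simplex with edges [g 0], [g 1], ... and base point 1. *)
Fixpoint vertex i (g : {ffun 'I_i -> G}) k : G :=
  if k is k'.+1 then (vertex g k' * (if insub k' is Some j then g j else 1))%g
  else 1%g.

Lemma vertexS i (g : {ffun 'I_i -> G}) (j : 'I_i) :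
  vertex g j.+1 = (vertex g j * g j)%g.
Proof. by rewrite /= valK. Qed.

Definition inhomog i (b : seq G -> M) : cochain M i :=
  [ffun g => b (mkseq (vertex g) i.+1)].

Lemma homogK i (f : cochain M i) : inhomog i (homog f) = f.
Proof.
apply/ffunP=> g; rewrite ffunE /homog nth_mkseq // gact1; congr (f _).
apply/ffunP=> j; have ji := ltn_ord j; have ji' := ltnW ji.
rewrite ffunE !nth_mkseq ?ltnS //.
by rewrite vertexS mulKg.
Qed.

Lemma inhomogK i (b : seq G -> M) s : size s = i.+1 ->
  (forall u g, size u = i.+1 -> b (mshift g u) = gact g (b u)) ->
  homog (inhomog i b) s = b s.
Proof.
move=> si bG; rewrite /homog ffunE -bG ?size_mkseq //; congr b.
apply: (@eq_from_nth _ 1%g); rewrite size_map size_mkseq // => k ki.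
rewrite (nth_map 1%g) ?size_mkseq // nth_mkseq //.
elim: k ki => [|k IHk] ki; first by rewrite mulg1.
have /= := vertexS (quotients i s) (Ordinal (ki : (k < i)%N)) => ->.
by rewrite ffunE mulgA IHk ?mulKVg // ltnW.
Qed.

Let full (u : M) := True.

Lemma hcochain_homog i (f : cochain M i) : hcochain full i.+1 (homog f).
Proof. by move=> s si; split=> // g; apply: homog_shift. Qed.

Lemma homog_cocycleP i (f : cochain M i) :
  is_cocycle f <-> hcocycle full i (homog f).
Proof.
split=> [/eqP f0|[_ df]].
  split=> [|s si]; first exact: hcochain_homog.
  by rewrite -homog_coboundary // f0 /homog ffunE gact0.
apply/eqP; rewrite -[LHS]homogK; apply/ffunP=> g; rewrite !ffunE.
by rewrite homog_coboundary ?df // size_mkseq.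
Qed.

Lemma homog_coboundaryP i (f : cochain M i.+1) :
  coboundary_prop f <-> hcob full i.+1 (homog f).
Proof.
split=> [[h ->]|[b Lb bE]].
  by exists (homog h) => [|s si]; [exact: hcochain_homog | exact: homog_coboundary].
exists (inhomog i b); rewrite -[LHS]homogK -[RHS]homogK; apply/ffunP=> g; rewrite !ffunE.
rewrite homog_coboundary ?size_mkseq // bE ?size_mkseq //.
apply: (eq_hd (k := i.+1)); last by rewrite size_mkseq.
by move=> u ui; rewrite inhomogK // => v h /Lb[].
Qed.

Lemma cocycleMn i m (z : cocycle M i) : val (z *+ m) = val z *+ m.
Proof. by apply: (morphB_Mn (phi := val : cocycle M i -> cochain M i)) => u v. Qed.

Lemma cohomology_eq0 i (z : cocycle M i) :
  (\pi_(cohomology M i)%qT z == 0 :> cohomology M i) = `[< coboundary_prop (val z) >].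
Proof.
have -> : (0 : cohomology M i) = \pi_(cohomology M i)%qT 0 by rewrite raddf0.
by rewrite -Quotient.idealrBE subr0.
Qed.

End Bar.

(** * Finite cohomology groups *)

Lemma finite_zmod (A : zmodType) N : ([set: A] #= `I_N)%card ->
  exists (F : finZmodType) (phi : F -> A),
    [/\ bijective phi, {morph phi : x y / x - y} & #|F| = N].
Proof.
move=> /card_set_bijP[f [f_fun f_inj f_surj]].
have fN x : (f x < N)%N by apply: f_fun.
have /choice[g gP] : forall k : 'I_N, exists x, f x = k.
  by move=> k; have [x _ xk] := f_surj k (ltn_ord k); exists x.
have fK : cancel (fun x => Ordinal (fN x)) g.
  by move=> x; apply: f_inj; rewrite ?inE //= gP.
have gK : cancel g (fun x => Ordinal (fN x)) by move=> k; apply/val_inj/gP.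
pose A1 : countType := HB.pack (GRing.Zmodule.sort A)
  (Choice_isCountable.Build A (pcan_pickleK (can_pcan fK))).
pose A2 : finType := HB.pack (GRing.Zmodule.sort A) A1 (@CanIsFinite A1 _ _ _ fK).
pose A3 : finZmodType := HB.pack (GRing.Zmodule.sort A) A A1 A2.
exists A3, id; split=> //; first by exists id.
by rewrite -[RHS]card_ord (bij_eq_card (f := fun x : A3 => Ordinal (fN x))) //; exists g.
Qed.

Lemma dvd_order_torsion (A : zmodType) p : prime p -> dvd_order p A ->
  exists2 x : A, x != 0 & x *+ p = 0.
Proof.
move=> p_pr [N /finite_zmod[F [phi [phi_bij phiB FN]]]].
rewrite -FN -cardsT => /(Cauchy (G := [set: F]%G) p_pr)[x _ xp].
have phi0 := morphB_0 phiB.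
exists (phi x).
  rewrite -phi0 (bij_eq phi_bij); apply/eqP=> x0.
  by move: p_pr; rewrite -xp x0 order1.
by rewrite -(morphB_Mn phiB) -FinRing.zmodXgE -xp expg_order.
Qed.

Lemma torsion_dvd_order (A : zmodType) p a (x : A) : prime p ->
  finite_set [set: A] -> x != 0 -> x *+ p ^ a = 0 -> dvd_order p A.
Proof.
move=> p_pr /finite_setP[N AN] x0 xpa; exists N => //.
have [F [phi [[psi psiK phiK] phiB FN]]] := finite_zmod AN.
have phi0 := morphB_0 phiB.
have yp : ((psi x : F) ^+ (p ^ a) == 1)%g.
  rewrite FinRing.zmodXgE -(inj_eq (can_inj psiK)) morphB_Mn // phiK xpa.
  by rewrite [X in _ == X]phi0.
have xN := order_dvdG (G := [set: F]%G) (finset.in_setT (psi x : F)).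
rewrite -FN -cardsT; apply: dvdn_trans xN.
move: yp; rewrite -order_dvdn => /(dvdn_pfactor _ _ p_pr)[[|b] _ xb].
  case/eqP: x0; rewrite -[x]phiK -phi0; congr (phi _).
  by apply/eqP; rewrite -[_ == _]order_eq1 xb.
by rewrite xb expnS dvdn_mulr.
Qed.

Section FiniteCohomology.
Variables (G : finGroupType) (M : gmodule G).
Let full (u : M) := True.

Lemma dvd_order_htors p i : prime p -> (0 < i)%N ->
  dvd_order p (cohomology M i) -> htors p i full.
Proof.
case: i => // i p_pr _ /(dvd_order_torsion p_pr)[x].
rewrite -[x]reprK; set z := repr x; rewrite cohomology_eq0 => /asboolP z0 /eqP.
have -> : (\pi_(cohomology M i.+1)%qT z *+ p : cohomology M i.+1)
          = \pi_(cohomology M i.+1)%qT (z *+ p) by rewrite raddfMn.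
rewrite cohomology_eq0 => /asboolP zp; exists (homog (val z)); split.
- by apply/homog_cocycleP; case: (z).
- by move/homog_coboundaryP.
exists 1%N; move: zp; rewrite cocycleMn => /homog_coboundaryP[b Lb bE].
by exists b => // s si; rewrite -bE // homogMn expn1.
Qed.

Lemma htors_dvd_order p i : prime p -> (0 < i)%N ->
  finite_set [set: cohomology M i] ->
  htors p i full -> dvd_order p (cohomology M i).
Proof.
case: i => // i p_pr _ fin [c [[Lc dc] nc [a ca]]].
pose f : cochain M i.+1 := inhomog i.+1 c.
have fE s : size s = i.+2 -> homog f s = c s.
  by move=> si; apply: inhomogK => // u g /Lc[].
have fz : is_cocycle f.
  apply/homog_cocycleP; split=> [|s si]; first exact: hcochain_homog.
  by rewrite (eq_hd fE) // dc.
pose z := Cocycle fz; apply: (@torsion_dvd_order _ p a (\pi_(cohomology M i.+1)%qT z)) => //.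
  rewrite cohomology_eq0; apply/asboolP => /homog_coboundaryP[b Lb bE].
  by apply: nc; exists b => // s si; rewrite -bE // fE.
apply/eqP; rewrite -raddfMn cohomology_eq0; apply/asboolP.
rewrite cocycleMn; apply/homog_coboundaryP; have [b Lb bE] := ca.
by exists b => // s si; rewrite -bE // homogMn fE.
Qed.

Lemma finite_cohomology i (K : finType) (q : cochain M i.+1 -> K) :
  (forall f h, is_cocycle f -> is_cocycle h -> q f = q h -> coboundary_prop (f - h)) ->
  finite_set [set: cohomology M i.+1].
Proof.
move=> qP; have /choice[r rP] : forall k : K, exists x : cohomology M i.+1,
    forall z : cocycle M i.+1, q (val z) = k -> \pi_(cohomology M i.+1)%qT z = x.
  move=> k; have [[z zk]|nz] := pselect (exists z : cocycle M i.+1, q (val z) = k).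
    exists (\pi_(cohomology M i.+1)%qT z) => w wk; apply/eqP; rewrite -subr_eq0 -raddfB.
    rewrite cohomology_eq0; apply/asboolP/qP; [exact: (valP w)|exact: (valP z)|].
    by rewrite zk.
  by exists 0 => z zk; case: nz; exists z.
apply: (sub_finite_set _ (finite_image r (@finite_finset K setT))) => x _ /=.
exists (q (val (repr x))) => //; rewrite -[RHS]reprK.
by apply/esym/rP.
Qed.
End FiniteCohomology.

(** * Column antisymmetrizers in tensor space *)

Section Tensor.
Variable N : nat.

Definition word n := {ffun 'I_n -> 'I_N}.
(** The n-th tensor power of the rational vector space on [N] rows: [v w] is the
    coefficient of the basis tensor with factors [w 0], [w 1], ... It
    contains the tabloids of all shapes of [n] with at most [N] rows. *)
Definition tens n := {ffun word n -> rat^o}.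

Definition wperm n (w : word n) (s : 'S_n) : word n := [ffun x => w (s x)].

Lemma wperm1 n (w : word n) : wperm w 1 = w.
Proof. by apply/ffunP=> x; rewrite ffunE perm1. Qed.

Lemma wpermM n (w : word n) s t : wperm w (s * t)%g = wperm (wperm w t) s.
Proof. by apply/ffunP=> x; rewrite !ffunE permM. Qed.

Lemma wperm_inj n s : injective (fun w : word n => wperm w s).
Proof.
by apply: (can_inj (g := fun w => wperm w s^-1%g)) => w; rewrite -wpermM mulVg wperm1.
Qed.

Definition wres n (a : 'I_n.+1) (w : word n.+1) : word n := [ffun x => w (lift a x)].

Definition wext n (w : word n) (r : 'I_N) : word n.+1 :=
  [ffun x => if unlift ord_max x is Some y then w y else r].

Definition wset n (w : word n) (x : 'I_n) (r : 'I_N) : word n :=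
  [ffun y => if y == x then r else w y].

Lemma wres_wext n (w : word n) r : wres ord_max (wext w r) = w.
Proof. by apply/ffunP=> x; rewrite !ffunE liftK. Qed.

Lemma wext_max n (w : word n) r : wext w r ord_max = r.
Proof. by rewrite ffunE unlift_none. Qed.

Lemma wext_lift n (w : word n) r x : wext w r (lift ord_max x) = w x.
Proof. by rewrite ffunE liftK. Qed.

Lemma eq_wres n (a : 'I_n.+1) (v w : word n.+1) :
  (v == w) = (v a == w a) && (wres a v == wres a w).
Proof.
apply/eqP/andP=> [->//|[/eqP va /eqP/ffunP vw]]; apply/ffunP=> x.
by case: (unliftP a x) => [y|] -> //; have := vw y; rewrite !ffunE.
Qed.

(** For the tableau with [x] in row [rho x] and column [gamma x], this is the
    polytabloid: tabloids are words listing the row of each letter, and the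
    stabilizer of [gamma] is the column stabilizer. *)
Definition asym n (gamma rho : word n) : tens n :=
  [ffun w => \sum_(s : 'S_n | wperm gamma s == gamma)
               (-1) ^+ s *+ (wperm rho s == w)].

(** Composing with the transposition of [x] and [y] fixes both words and changes
    the sign of each term. *)
Lemma asym_eq0 n (gamma rho : word n) x y : x != y ->
  gamma x = gamma y -> rho x = rho y -> asym gamma rho = 0.
Proof.
move=> xy gxy rxy; apply/ffunP=> w; rewrite !ffunE.
have wt (v : word n) : v x = v y -> wperm v (tperm x y) = v.
  by move=> vxy; apply/ffunP=> z; rewrite ffunE; case: tpermP => // ->.
set S := \sum_(s | _) _; suff: S = - S.
  by move=> /eqP; rewrite -subr_eq0 opprK -mulr2n mulrn_eq0 => /eqP.
rewrite -sumrN {1}/S (reindex_inj (mulIg (tperm x y))) /=.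
apply: eq_big => [s|s _]; first by rewrite wpermM wt.
by rewrite wpermM wt // odd_permM odd_tperm xy signr_addb /= expr1 mulrN1 mulNrn.
Qed.

Lemma lift_perm_bij n (a : 'I_n.+1) :
  {on [pred s : 'S_n.+1 | s a == a], bijective (lift_perm a a)}.
Proof.
pose f (s : 'S_n.+1) (k : 'I_n) := odflt k (unlift a (s (lift a k))).
have fK (s : 'S_n.+1) (k : 'I_n) : s a = a -> lift a (f s k) = s (lift a k).
  move=> sa; rewrite /f; case: unliftP => [j ->//|/= sk].
  by case/eqP: (neq_lift a k); apply: (@perm_inj _ s); rewrite sk.
have f_inj (s : 'S_n.+1) : s a = a -> injective (f s).
  move=> sa j k /(congr1 (lift a)); rewrite !fK // => /perm_inj.
  exact: lift_inj.
pose g (s : 'S_n.+1) : 'S_n :=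
  if @idP (s a == a) is ReflectT sa then perm (f_inj s (eqP sa)) else 1%g.
have gE (s : 'S_n.+1) (k : 'I_n) : s a = a -> g s k = f s k.
  move=> sa; rewrite /g; case: {-}_ / idP => [sa'|]; first by rewrite permE.
  by rewrite sa eqxx.
exists g => [s _|s /eqP sa]; apply/permP=> k.
  by rewrite gE ?lift_perm_id // /f lift_perm_lift liftK.
by case: (unliftP a k) => [j|] ->; rewrite ?lift_perm_id // lift_perm_lift gE // fK.
Qed.

Lemma wperm_lift n (a : 'I_n.+1) (v w : word n.+1) s :
  (wperm v (lift_perm a a s) == w) = (v a == w a) && (wperm (wres a v) s == wres a w).
Proof.
rewrite (eq_wres a) ffunE lift_perm_id; congr (_ && (_ == _)).
by apply/ffunP=> x; rewrite !ffunE lift_perm_lift.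
Qed.

Lemma asym_fix n (a : 'I_n.+1) (gamma rho w : word n.+1) :
  \sum_(s : 'S_n.+1 | (wperm gamma s == gamma) && (s a == a))
     (-1) ^+ s *+ (wperm rho s == w)
  = asym (wres a gamma) (wres a rho) (wres a w) *+ (rho a == w a) :> rat.
Proof.
have lpb : {on [pred s : 'S_n.+1 | (wperm gamma s == gamma) && (s a == a)],
    bijective (lift_perm a a)}.
  by apply: (subon_bij _ (lift_perm_bij a)) => s /andP[].
rewrite (reindex _ lpb) /= ffunE -sumrMnl.
apply: eq_big => [s|s _]; first by rewrite wperm_lift lift_perm_id !eqxx andbT.
rewrite wperm_lift odd_lift_perm addbb -mulrnA mulnb.
by rewrite andbC.
Qed.

(** Expansion along the letter [x0]: the permutation [s] is sorted by the letter
    [a] that it sends to [x0]. As the entry of [rho] at [x0] only matters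
    through the condition on [w a], it may be replaced by any row [r]. *)
Lemma asym_expand n (gamma rho w : word n.+1) x0 r :
  asym gamma (wset rho x0 r) w =
  \sum_(a | w a == r) (if gamma a == gamma x0 then
     (-1) ^+ (x0 != a) * asym (wres a gamma) (wres a (wperm rho (tperm x0 a))) (wres a w)
     else 0) :> rat.
Proof.
rewrite ffunE (partition_big (fun s : 'S_n.+1 => s^-1%g x0) xpredT) //=.
rewrite [RHS]big_mkcond; apply: eq_bigr => a _.
have [ga|ga] := eqVneq (gamma a) (gamma x0); last first.
  rewrite if_same big1 // => s /andP[/eqP/ffunP/(_ a)].
  rewrite ffunE => sa /eqP sx0; case/eqP: ga.
  by rewrite -sa -sx0 permKV.
have gt : wperm gamma (tperm x0 a) = gamma.
  by apply/ffunP=> z; rewrite ffunE; case: tpermP => // ->.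
rewrite (reindex_inj (mulIg (tperm x0 a))) /=.
transitivity (\sum_(s : 'S_n.+1 | (wperm gamma s == gamma) && (s a == a))
    (-1) ^+ (x0 != a) * ((-1) ^+ s *+ (wperm (wperm (wset rho x0 r) (tperm x0 a)) s == w)) : rat).
  apply: eq_big => [s|s _].
    rewrite wpermM gt; congr (_ && _); rewrite invMg tpermV permM tpermL.
    by rewrite -(inj_eq (@perm_inj _ s)) permKV eq_sym.
  rewrite odd_permM odd_tperm wpermM addbC signr_addb mulrnAr //.
rewrite -mulr_sumr asym_fix.
have -> : wres a (wperm (wset rho x0 r) (tperm x0 a)) = wres a (wperm rho (tperm x0 a)).
  apply/ffunP=> x; rewrite !ffunE ifN // -{2}(tpermR x0 a) (inj_eq perm_inj).
  by rewrite eq_sym neq_lift.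
rewrite !ffunE tpermR eqxx [w a == r]eq_sym.
by case: ifP => _; rewrite ?mulr0n ?mulr0.
Qed.

Lemma wset_id n (rho : word n) x : wset rho x (rho x) = rho.
Proof. by apply/ffunP=> y; rewrite ffunE; case: eqP => [->|]. Qed.

(** Restriction: contract with the row [r] at the last letter. If no other
    letter of its column is in row [r], only permutations that fix it
    contribute. *)
Lemma asym_wext n (gamma rho : word n.+1) r (w : word n) :
  (forall x, gamma x = gamma ord_max -> rho x = r -> x = ord_max) ->
  asym gamma rho (wext w r)
  = asym (wres ord_max gamma) (wres ord_max rho) w *+ (rho ord_max == r) :> rat.
Proof.
move=> H; rewrite -[in RHS](wres_wext w r) -[X in _ == X](wext_max w r) -asym_fix ffunE.
rewrite big_mkcondr; apply: eq_bigr => s /eqP/ffunP/(_ ord_max).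
rewrite ffunE => sg; have [//|sm] := eqVneq (s ord_max) ord_max.
have [/ffunP/(_ ord_max)|//] := wperm rho s =P wext w r.
by rewrite ffunE wext_max => /(H _ sg)/eqP; rewrite (negPf sm).
Qed.

(** * Tableaux *)

Definition tab n (l : nat -> nat) (t : word n * word n) :=
  [/\ forall x y, t.1 x = t.1 y -> t.2 x = t.2 y -> x = y,
      forall x, (t.2 x < l (t.1 x))%N
    & forall r c : 'I_N, (c < l r)%N -> exists x, t.1 x = r /\ t.2 x = c].

Definition add_node (l : nat -> nat) r k := (l k + (k == r))%N.

Definition part (l : nat -> nat) := forall k, (l k.+1 <= l k)%N.

Lemma part_leq l : part l -> forall j k, (j <= k)%N -> (l k <= l j)%N.
Proof.
move=> pl j k; elim: k => [|k IHk]; first by rewrite leqn0 => /eqP->.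
by rewrite leq_eqVlt => /orP[/eqP-> //|/IHk]; apply: leq_trans (pl k).
Qed.

Lemma tab_wext n (l : nat -> nat) (t : word n * word n) (r c : 'I_N) :
  l r = c -> tab l t ->
  tab (add_node l r) (wext t.1 r, wext t.2 c).
Proof.
move=> lr [tI tl ts]; split=> /= [x y|x|r' c'].
- case: (unliftP ord_max x) => [x'|] ->; case: (unliftP ord_max y) => [y'|] -> //;
    rewrite ?wext_lift ?wext_max //.
  + by move=> rxy cxy; rewrite (tI x' y').
  + by move=> xr xc; have := tl x'; rewrite xr xc lr ltnn.
  by move=> xr xc; have := tl y'; rewrite -xr -xc lr ltnn.
- case: (unliftP ord_max x) => [x'|] ->; rewrite ?wext_lift ?wext_max /add_node.
    by rewrite (leq_trans (tl x')) // leq_addr.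
  by rewrite eqxx lr addn1.
rewrite /add_node; have [lc _|lc] := ltnP c' (l r').
  have [x [xr xc]] := ts r' c' lc; exists (lift ord_max x).
  by rewrite !wext_lift.
have [rr'|] := eqVneq (r' : nat) r; last by rewrite addn0 ltnNge lc.
move=> cl; exists ord_max; rewrite !wext_max; split; apply/val_inj; first by rewrite /= rr'.
by apply/eqP; rewrite eqn_leq /= -lr -rr' lc /= -ltnS; rewrite addn1 in cl.
Qed.

Lemma tab_wres n (l : nat -> nat) (t : word n.+1 * word n.+1) (a : 'I_n.+1) :
  tab (add_node l (t.1 a)) t -> l (t.1 a) = t.2 a -> tab l (wres a t.1, wres a t.2).
Proof.
move=> [tI tl ts] la; split=> /= [x y|x|r c].
- by rewrite !ffunE => rxy cxy; apply: (@lift_inj _ a); apply: tI.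
- rewrite !ffunE; have := tl (lift a x); rewrite /add_node.
  have [ra|] := eqVneq (t.1 (lift a x) : nat) (t.1 a); last by rewrite addn0.
  rewrite addn1 ltnS leq_eqVlt => /orP[/eqP|//]; rewrite ra la => ca.
  case/eqP: (neq_lift a x); apply: tI; apply/val_inj => //; by rewrite /= ?ra ?ca.
move=> cl; have [|x [xr xc]] := ts r c; first by rewrite /add_node ltn_addr.
case: (unliftP a x) => [y xy|xa]; first by exists y; rewrite !ffunE -xy.
by move: cl; rewrite -xr -xc xa la ltnn.
Qed.

Lemma tab_wperm n l (t : word n * word n) s :
  tab l t -> tab l (wperm t.1 s, wperm t.2 s).
Proof.
move=> [tI tl ts]; split=> /= [x y|x|r c].
- by rewrite !ffunE => rxy cxy; apply: (@perm_inj _ s); apply: tI.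
- by rewrite !ffunE.
by move=> /ts[x [xr xc]]; exists (s^-1%g x); rewrite !ffunE permKV.
Qed.

End Tensor.

(** * Filtrations by successive kernels *)

(** The common kernels in [L] of the first maps of the list decrease to 0, and the
    quotient of each one by the next is [K r]. *)
Fixpoint filtered (V W : zmodType) (I : Type) (phi : I -> V -> W)
    (K : I -> W -> Prop) (rs : seq I) (L : V -> Prop) : Prop :=
  if rs is r :: rs' then
    [/\ forall x, L x -> K r (phi r x),
        forall y, K r y -> exists2 x, L x & phi r x = y
      & filtered phi K rs' (fun x => L x /\ phi r x = 0)]
  else forall x, L x -> x = 0.

Lemma htors_filtered (G : finGroupType) (M N : gmodule G) (I : eqType)
    (phi : I -> M -> N) (K : I -> N -> Prop) p i rs L :
  prime p -> (0 < i)%N ->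
  (forall r, {morph phi r : u v / u - v}) ->
  (forall r g u, phi r (gact g u) = gact g (phi r u)) ->
  substable L -> filtered phi K rs L ->
  htors p i L -> exists2 r, r \in rs & htors p i (K r).
Proof.
move=> p_pr i0 phiB phiG; elim: rs L => [|r rs IHrs] L Lst /=.
  move=> L0 [c [[Lc dc] nc _]]; case: nc; exists (fun=> 0).
    by move=> s _; split=> [|g]; [case: Lst | rewrite gact0].
  move=> s si; rewrite (L0 _ (proj1 (Lc s si))).
  by rewrite hd0.
move=> [LK KL chain] Lt.
have [Kt|Kt] := htors_devissage (phiB r) (phiG r) Lst LK KL p_pr i0 Lt; last first.
  by exists r => //; rewrite mem_head.
have [s srs st] := IHrs _ (ker_stable (phiB r) (phiG r) Lst) chain Kt.
by exists s => //; rewrite inE srs orbT.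
Qed.

Section Dimension.
Variables (V W : vectType rat) (I : eqType) (phi : I -> 'Hom(V, W)).
Variables (gen : I -> W -> Prop) (S : I -> {vspace W}) (prec : rel I).
Hypothesis S_gen : forall r (U : {vspace W}),
  (forall y, gen r y -> y \in U) -> (S r <= U)%VS.

(** This makes [S r] part of the image under [phi r] of the common kernel of the
    earlier maps, so that the [S r] are successive subquotients. *)
Definition triangular (rs : seq I) (A : V -> Prop) := forall r, r \in rs ->
  forall y, gen r y -> exists x, [/\ A x, phi r x = y
    & forall q, prec q r -> phi q x = 0].

Let triangular_ker r rs A : all (prec r) rs ->
  triangular (r :: rs) A -> triangular rs (fun x => A x /\ phi r x = 0).
Proof.
move=> /allP rrs Ars s srs y ys; have [|x [Ax xy xq]] := Ars s _ y ys.
  by rewrite inE srs orbT.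
by exists x; split=> //; split=> //; apply/xq/rrs.
Qed.

Let sub_image r rs (A : {vspace V}) : triangular (r :: rs) (fun x => x \in A) ->
  (S r <= phi r @: A)%VS.
Proof.
move=> Ars; apply: S_gen => y /(Ars r (mem_head _ _))[x [Ax <- _]].
exact: memv_img.
Qed.

Let triangular_cap r rs (A : {vspace V}) : all (prec r) rs ->
  triangular (r :: rs) (fun x => x \in A) ->
  triangular rs (fun x => x \in (A :&: lker (phi r))%VS).
Proof.
move=> rrs /(triangular_ker rrs) Ars s srs y /(Ars s srs y)[x [[Ax x0] xy xq]].
by exists x; split; rewrite // memv_cap Ax memv_ker x0 eqxx.
Qed.

Lemma sum_dim_triangular rs (A : {vspace V}) : pairwise prec rs ->
  triangular rs (fun x => x \in A) -> (\sum_(r <- rs) \dim (S r) <= \dim A)%N.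
Proof.
elim: rs A => [|r rs IHrs] A /=; first by rewrite big_nil.
move=> /andP[rrs /IHrs{}IHrs] Ars; rewrite big_cons -(limg_ker_dim (phi r)) addnC.
apply: leq_add; last exact/dimvS/sub_image/Ars.
exact/IHrs/triangular_cap.
Qed.

Variables (intV : V -> Prop) (intW : W -> Prop) (K : I -> W -> Prop).
Hypotheses (intVB : forall x y, intV x -> intV y -> intV (x - y))
  (phi_int : forall r x, intV x -> intW (phi r x)).
Hypothesis K_gen : forall r (P : W -> Prop), P 0 ->
  (forall x y, P x -> P y -> P (x - y)) -> (forall y, gen r y -> P y) ->
  forall y, K r y -> P y.

(** If the dimensions add up, then each quotient of successive kernels is
    exactly [S r] and nothing is left at the end. If moreover the lattices [K r]
    are saturated, then the same holds for lattices, and [L] is saturated. *)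
Lemma filtered_saturated rs (A : {vspace V}) (L : V -> Prop) :
  pairwise prec rs -> triangular rs L ->
  L 0 -> (forall x y, L x -> L y -> L (x - y)) ->
  (forall x, L x -> x \in A /\ intV x) ->
  (forall r, r \in rs -> forall y, y \in S r -> intW y -> K r y) ->
  (\dim A <= \sum_(r <- rs) \dim (S r))%N ->
  filtered phi K rs L /\ (forall x, x \in A -> intV x -> L x).
Proof.
elim: rs A L => [|r rs IHrs] A L /=.
  rewrite big_nil leqn0 dimv_eq0 => _ _ L0 _ LA _ /eqP A0.
  have x0 x : x \in A -> x = 0 by rewrite A0 memv0 => /eqP.
  by split=> [x /LA[/x0]|x /x0->].
move=> /andP[rrs prs] Lrs L0 LB LA Ksat dimA.
have Ars : triangular (r :: rs) (fun x => x \in A).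
  by move=> s srs y /(Lrs s srs y)[x [/LA[Ax _] xy xq]]; exists x.
have dim_ker := sum_dim_triangular prs (triangular_cap rrs Ars).
have SA := sub_image Ars; have dim_im := dimvS SA.
have dim_eq := limg_ker_dim (phi r) A.
rewrite big_cons in dimA.
have imA : (phi r @: A)%VS = S r.
  by apply/esym/eqP; rewrite eqEdim SA; lia.
have KL y : K r y -> exists2 x, L x & phi r x = y.
  move: y; apply: (@K_gen r (fun y => exists2 x, L x & phi r x = y)) =>
    [|x y [x' Lx <-] [y' Ly <-]|y /(Lrs r (mem_head _ _))[x [Lx xy _]]].
  - by exists 0; rewrite ?linear0.
  - by exists (x' - y'); [exact: LB | rewrite linearB].
  by exists x.
have [||||||chain Lsat] :=
    IHrs (A :&: lker (phi r))%VS (fun x => L x /\ phi r x = 0) prs.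
- exact: triangular_ker Lrs.
- by rewrite linear0.
- by move=> x y [Lx x0] [Ly y0]; split; [exact: LB | rewrite linearB /= x0 y0 subr0].
- by move=> x [Lx x0]; have [Ax ?] := LA x Lx; rewrite memv_cap memv_ker Ax x0 eqxx.
- by move=> s srs; apply: Ksat; rewrite inE srs orbT.
- by lia.
have LK x : x \in A -> intV x -> K r (phi r x).
  by move=> Ax /phi_int xi; apply: Ksat; rewrite ?mem_head // -imA memv_img.
split=> [|x Ax xi]; first by split=> // x /LA[]; apply: LK.
have [x' Lx' xx'] := KL _ (LK x Ax xi); have [Ax' xi'] := LA x' Lx'.
suff [Lxx _] : L (x - x') /\ phi r (x - x') = 0.
  have -> : x = (x - x') - (0 - x') by rewrite sub0r opprK subrK.
  by apply: (LB _ _ Lxx); apply: LB.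
apply: Lsat; last exact: intVB.
by rewrite memv_cap memv_ker memvB // linearB /= xx' subrr.
Qed.

End Dimension.

(** * Young's lattice *)

Section Young.
Variable N : nat.
Implicit Types (l : nat -> nat) (n r s k : nat).

Definition rem_node l r k := (l k - (k == r))%N.

Definition removable l r := (0 < l r)%N /\ part (rem_node l r).

Definition yshape n l :=
  [/\ part l, forall k, (N <= k)%N -> l k = 0%N & (\sum_(k < N) l k)%N = n].

Lemma rem_nodeK l r : (0 < l r)%N -> add_node (rem_node l r) r = l.
Proof. by move=> lr; apply/funext=> k; rewrite /add_node /rem_node; case: eqP => [->|]; lia. Qed.

Lemma add_nodeK l r : rem_node (add_node l r) r = l.
Proof. by apply/funext=> k; rewrite /add_node /rem_node addnK. Qed.

Lemma rem_add_node l r s : r <> s -> rem_node (add_node l r) s = add_node (rem_node l s) r.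
Proof.
move=> rs; apply/funext=> k; rewrite /add_node /rem_node.
by case: (k =P s) => [->|_]; [case: (s =P r) => [/esym//|]; lia | lia].
Qed.

Lemma sum_add_node l r : (r < N)%N ->
  (\sum_(k < N) add_node l r k = (\sum_(k < N) l k).+1)%N.
Proof.
move=> rN; rewrite /add_node big_split /= -addn1; congr addn.
by rewrite (bigD1 (Ordinal rN)) //= eqxx big1 // => k; rewrite -val_eqE /= => /negPf->.
Qed.

Lemma shape_add_node n l r : yshape n l -> (r < N)%N -> part (add_node l r) ->
  yshape n.+1 (add_node l r).
Proof.
move=> [pl l0 ln] rN pa; split=> // [k kN|]; last by rewrite sum_add_node ?ln.
by rewrite /add_node l0 //; case: eqP => //; lia.
Qed.

Lemma shape_rem_node n l r : yshape n.+1 l -> (r < N)%N -> removable l r ->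
  yshape n (rem_node l r).
Proof.
move=> [pl l0 ln] rN [lr pr]; split=> // [k kN|]; first by rewrite /rem_node l0.
by apply: succn_inj; rewrite -(sum_add_node _ rN) rem_nodeK.
Qed.

Lemma shape_le n l k : yshape n l -> (l k <= n)%N.
Proof.
move=> [pl l0 <-]; have [kN|/l0->//] := ltnP k N.
by rewrite (bigD1 (Ordinal kN)) //= leq_addr.
Qed.

Lemma shape_eq0 n l : yshape n l -> l n = 0%N.
Proof.
move=> [pl l0 ln]; have [nN|/l0//] := ltnP n N; apply/eqP; rewrite -leqn0 leqNgt.
apply/negP=> ln0; suff: (n < n)%N by rewrite ltnn.
rewrite -{2}ln -(subnKC nN) big_split_ord /=.
apply: leq_trans (leq_addr _ _); rewrite -[X in (X <= _)%N]card_ord -sum1_card.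
apply: leq_sum => k _; apply: leq_trans ln0 (part_leq pl _).
by rewrite -ltnS.
Qed.

Lemma removable_ex n l : yshape n.+1 l -> exists2 r, (r < N)%N & removable l r.
Proof.
move=> sl; have [pl l0 ln] := sl; pose P k := l k == 0%N.
have [|r /eqP lr rmin] := ex_minnP (P := P); first by exists n.+1; apply/eqP/shape_eq0.
case: r lr rmin => [|r] lr rmin.
  by move: ln; rewrite big1 // => k _; have := part_leq pl (leq0n k); lia.
have lr0 : (0 < l r)%N by rewrite lt0n; apply/negP=> /rmin; rewrite ltnn.
exists r; first by rewrite ltnNge; apply/negP=> /l0; lia.
split=> // k; have := pl k; rewrite /rem_node; case: (k =P r) => [->|]; lia.
Qed.

(** Adding and removing different nodes commute: both orders lead to the same
    intermediate shapes, since [l] and [rem_node (add_node l r) s] are partitions if and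
    only if their join [add_node l r] and their meet [rem_node l s] are. For the same
    node, there is exactly one more addable than removable row. *)
Lemma add_rem_nodeC l (F : (nat -> nat) -> nat) : part l -> l N = 0%N ->
  (\sum_(r < N.+1 | `[< part (add_node l r) >])
     \sum_(s < N.+1 | `[< removable (add_node l r) s >]) F (rem_node (add_node l r) s)
   = F l + \sum_(s < N.+1 | `[< removable l s >])
     \sum_(r < N.+1 | `[< part (add_node (rem_node l s) r) >]) F (add_node (rem_node l s) r))%N.
Proof.
move=> pl lN.
have off (r s : 'I_N.+1) : r != s ->
    `[< part (add_node l r) >] && `[< removable (add_node l r) s >]
    = `[< removable l s >] && `[< part (add_node (rem_node l s) r) >].
  rewrite -val_eqE /= => rs; apply/andP/andP => -[/asboolP A /asboolP B].
    case: B => ls; rewrite rem_add_node; last exact/eqP.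
    move=> C; have ls' : (0 < l s)%N by move: ls; rewrite /add_node; lia.
    split; apply/asboolP => //; split=> // k.
    by have := pl k; have := C k; have := C s; rewrite /add_node /rem_node; lia.
  case: A => ls pr; split; apply/asboolP.
    move=> k; have := pl k; have := B k; have := pr k.
    by rewrite /add_node /rem_node; lia.
  by split; [rewrite /add_node; lia | rewrite rem_add_node //; apply/eqP].
pose G (r s : 'I_N.+1) : nat :=
  if `[< part (add_node l r) >] && `[< removable (add_node l r) s >]
  then F (rem_node (add_node l r) s) else 0%N.
pose H (r s : 'I_N.+1) : nat :=
  if `[< removable l s >] && `[< part (add_node (rem_node l s) r) >]
  then F (add_node (rem_node l s) r) else 0%N.
transitivity (\sum_r \sum_s G r s)%N.
  rewrite big_mkcond; apply: eq_bigr => r _; rewrite /G.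
  by case: `[< _ >] => /=; [rewrite big_mkcond | rewrite big1].
transitivity (F l + \sum_r \sum_s H r s)%N; last first.
  rewrite exchange_big [in RHS]big_mkcond; congr addn; apply: eq_bigr => s _; rewrite /H.
  by case: `[< _ >] => /=; [rewrite [in RHS]big_mkcond | rewrite big1].
have split_diag (K : 'I_N.+1 -> 'I_N.+1 -> nat) :
    (\sum_r \sum_s K r s = \sum_r K r r + \sum_r \sum_(s | s != r) K r s)%N.
  by rewrite -big_split; apply: eq_bigr => r _; rewrite (bigD1 r).
rewrite !split_diag addnA; congr addn; last first.
  apply: eq_bigr => r _; apply: eq_bigr => s sr; rewrite eq_sym in sr.
  by rewrite /G /H off //; case: ifP => // _; rewrite rem_add_node //; apply/eqP.
have GE (r : 'I_N.+1) : G r r = (if `[< part (add_node l r) >] then F l else 0)%N.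
  rewrite /G add_nodeK; congr (if _ then _ else _); rewrite andb_idr // => _.
  by apply/asboolP; split; rewrite ?add_nodeK // /add_node eqxx addn1.
have HE (r : 'I_N.+1) : H r r = (if `[< removable l r >] then F l else 0)%N.
  rewrite /H; have [[lr plr]|nr] := pselect (removable l r); last by rewrite asboolF.
  by rewrite rem_nodeK // asboolT // asboolT.
under eq_bigr do rewrite GE; under [in RHS]eq_bigr do rewrite HE.
rewrite big_ord_recl [in RHS]big_ord_recr /= asboolT; last first.
  by move=> k; have := pl k; rewrite /add_node; lia.
rewrite [`[< removable l N >]]asboolF ?addn0; last by case; rewrite lN.
congr addn; apply: eq_bigr => k _; congr (if _ then _ else _).
rewrite /bump leq0n add1n; apply/asboolP/asboolP => [pa|[lk pr] j].
  have := pa k; rewrite /add_node eqxx => lk; split; first by lia.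
  by move=> j; have := pl j; rewrite /rem_node; case: (j =P k) => [->|]; lia.
have := pl j; have := pr k; rewrite /add_node /rem_node eqxx.
by case: (j =P k) => [->|]; lia.
Qed.

End Young.

Lemma leq_sum_eq (I : finType) (P : pred I) (E F : I -> nat) :
  (forall i, P i -> (E i <= F i)%N) -> (\sum_(i | P i) F i <= \sum_(i | P i) E i)%N ->
  forall i, P i -> E i = F i.
Proof.
move=> EF FE i Pi; apply/eqP; rewrite eqn_leq EF //=; move: FE.
rewrite (bigD1 i) // [X in (_ <= X)%N -> _](bigD1 i) //=.
have : (\sum_(j | P j && (j != i)) E j <= \sum_(j | P j && (j != i)) F j)%N.
  by apply: leq_sum => j /andP[/EF].
by lia.
Qed.

Section Branching.
Variables (N : nat) (d : nat -> (nat -> nat) -> nat).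
Hypothesis d_rem : forall n l, (n < N)%N -> yshape N.+1 n.+1 l ->
  (\sum_(r < N.+1 | `[< removable l r >]) d n (rem_node l r) <= d n.+1 l)%N.
Hypothesis d_add : forall n l, (n < N)%N -> yshape N.+1 n l ->
  (\sum_(r < N.+1 | `[< part (add_node l r) >]) d n.+1 (add_node l r) <= n.+1 * d n l)%N.

Let branching_step n : (n < N)%N ->
  (forall l, yshape N.+1 n l ->
    (\sum_(r < N.+1 | `[< part (add_node l r) >])
     \sum_(s < N.+1 | `[< removable (add_node l r) s >]) d n (rem_node (add_node l r) s)
     = n.+1 * d n l)%N) ->
  (forall l, yshape N.+1 n l ->
    (\sum_(r < N.+1 | `[< part (add_node l r) >]) d n.+1 (add_node l r) = n.+1 * d n l)%N)
  /\ (forall l, yshape N.+1 n.+1 l ->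
    (\sum_(r < N.+1 | `[< removable l r >]) d n (rem_node l r) = d n.+1 l)%N).
Proof.
move=> nN up_down.
have rem_le l (r : 'I_N.+1) : yshape N.+1 n l -> `[< part (add_node l r) >] ->
    (\sum_(s < N.+1 | `[< removable (add_node l r) s >]) d n (rem_node (add_node l r) s)
     <= d n.+1 (add_node l r))%N.
  by move=> sl /asboolP pa; apply: d_rem => //; apply: shape_add_node.
split=> l sl.
  apply/eqP; rewrite eqn_leq d_add //= -up_down //.
  by apply: leq_sum => r /(rem_le _ _ sl).
have [s sN ls] := removable_ex sl; have lss := shape_rem_node sl sN ls.
have lE : add_node (rem_node l s) s = l by rewrite rem_nodeK //; case: ls.
have E := leq_sum_eq (fun r => rem_le _ r lss); rewrite up_down // d_add // in E.
have /= := E isT (Ordinal sN); rewrite lE; apply.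
by apply/asboolP; case: sl.
Qed.

(** Going up and then down from [l] gives [n.+1 * d n l] by the rules for
    smaller shapes, and it bounds going up from below; so going up, which is
    bounded by the same number from above, leaves no slack anywhere. *)
Lemma branching_eq n : (n < N)%N ->
  (forall l, yshape N.+1 n l ->
    (\sum_(r < N.+1 | `[< part (add_node l r) >]) d n.+1 (add_node l r) = n.+1 * d n l)%N)
  /\ (forall l, yshape N.+1 n.+1 l ->
    (\sum_(r < N.+1 | `[< removable l r >]) d n (rem_node l r) = d n.+1 l)%N).
Proof.
elim: n => [|n IHn] nN.
  have up_down l : yshape N.+1 0 l ->
    (\sum_(r < N.+1 | `[< part (add_node l r) >])
     \sum_(s < N.+1 | `[< removable (add_node l r) s >]) d 0 (rem_node (add_node l r) s)
     = 1 * d 0 l)%N.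
    move=> sl; have [pl l0 _] := sl; have ln k : l k = 0%N by have := shape_le k sl; lia.
    rewrite add_rem_nodeC // [X in (_ + X)%N]big1 ?mul1n ?addn0 // => s /asboolP[].
    by rewrite ln.
  exact: branching_step nN up_down.
apply: (branching_step nN) => l sl; have [pl l0 _] := sl.
have [Pn Qn] := IHn (ltnW nN).
have lN : l N = 0%N.
  by apply/eqP; rewrite -leqn0 -(shape_eq0 sl); apply: (part_leq pl (ltnW nN)).
rewrite add_rem_nodeC // mulSn -(Qn _ sl) big_distrr; congr addn.
apply: eq_bigr => s /asboolP ls; apply: Pn.
exact: shape_rem_node ls.
Qed.
End Branching.

(** * Specht modules and lattices in tensor space *)

Section SpechtLattice.
Variable N : nat.
Notation word := (word N).
Notation tens := (tens N).

Definition polytab n (t : word n * word n) : tens n := asym t.2 t.1.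

Definition tabs n l : {pred word n * word n} := [pred t | `[< tab l t >]].

Definition spechtQ n l : {vspace tens n} :=
  <<[seq polytab t | t <- enum (@tabs n l)]>>%VS.

Definition spechtZ n l (v : tens n) : Prop :=
  exists c : word n * word n -> int, v = \sum_(t in @tabs n l) polytab t *~ c t.

Definition integral n (v : tens n) := forall w, (v w : rat) \is a Num.int.

Lemma spechtQ_gen n l (U : {vspace tens n}) :
  (forall t, tab l t -> polytab t \in U) -> (spechtQ n l <= U)%VS.
Proof.
move=> tU; apply/span_subvP => _ /mapP[t + ->].
by rewrite mem_enum => /asboolP/tU.
Qed.

Lemma mem_spechtQ n l t : tab l t -> polytab t \in spechtQ n l.
Proof.
by move=> tl; apply/memv_span/map_f; rewrite mem_enum; apply/asboolP.
Qed.

Lemma spechtZ_0 n l : spechtZ l (0 : tens n).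
Proof. by exists (fun=> 0); rewrite big1. Qed.

Lemma spechtZ_B n l (u v : tens n) : spechtZ l u -> spechtZ l v -> spechtZ l (u - v).
Proof.
move=> [c ->] [d ->]; exists (fun t => c t - d t).
by rewrite -sumrB; apply: eq_bigr => t _; rewrite mulrzBr.
Qed.

Lemma mem_spechtZ n l (t : word n * word n) : tab l t -> spechtZ l (polytab t).
Proof.
move=> tl; exists (fun u => (u == t)%:R).
rewrite (bigD1 t) /=; last exact/asboolP.
by rewrite eqxx mulr1z big1 ?addr0 // => u /andP[_ /negPf->].
Qed.

Lemma spechtZ_gen n l (P : tens n -> Prop) : P 0 ->
  (forall u v, P u -> P v -> P (u - v)) -> (forall t, tab l t -> P (polytab t)) ->
  forall v, spechtZ l v -> P v.
Proof.
move=> P0 PB Pt v [c ->]; apply: subgroup_sum => // t /asboolP/Pt.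
exact: subgroupMz.
Qed.

Lemma integralB n (u v : tens n) : integral u -> integral v -> integral (u - v).
Proof. by move=> ui vi w; rewrite !ffunE rpredB. Qed.

Lemma integral_polytab n (t : word n * word n) : integral (polytab t).
Proof.
move=> w; rewrite ffunE; apply: rpred_sum => s _.
by apply: rpredMn; apply: rpredX; rewrite rpredN1.
Qed.

Lemma spechtZ_spechtQ n l (v : tens n) : spechtZ l v -> v \in spechtQ n l /\ integral v.
Proof.
move: v; apply: (@spechtZ_gen n l (fun v => v \in spechtQ n l /\ integral v)) =>
    [|u v [uQ ui] [vQ vi]|t tl].
- by split=> [|w]; rewrite ?mem0v // ffunE rpred0.
- by split; [exact: memvB | exact: integralB].
by split; [exact: mem_spechtQ | exact: integral_polytab].
Qed.

(** ** The action of the symmetric group *)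

Definition tact n (g : 'S_n) (v : tens n) : tens n := [ffun w => v (wperm w g^-1%g)].

Definition tens_mod n : gmodule (perm_of 'I_n).
Proof.
refine (@GModule _ (tens n) (@tact n) _ _ _).
- by move=> g u v; apply/ffunP=> w; rewrite !ffunE.
- by move=> u; apply/ffunP=> w; rewrite ffunE invg1 wperm1.
by move=> g h u; apply/ffunP=> w; rewrite !ffunE invMg wpermM.
Defined.

Lemma tact_polytab n (g : 'S_n) t : tact g (polytab t) = polytab (wperm t.1 g, wperm t.2 g).
Proof.
apply/ffunP=> w; rewrite !ffunE [RHS](reindex_inj (conjg_inj (g^-1)%g)) /=.
have gE s : (s ^ g^-1 * g = g * s)%g by rewrite conjgE invgK -!mulgA mulVg mulg1.
apply: eq_big => [s|s _].
  by rewrite -wpermM gE wpermM (inj_eq (@wperm_inj _ _ _)).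
rewrite odd_permJ -wpermM gE wpermM; congr (_ *+ nat_of_bool _).
by rewrite -(inj_eq (@wperm_inj _ _ g)) -(wpermM w) mulgV wperm1.
Qed.

Lemma spechtZ_stable n l : substable (@spechtZ n l : tens_mod n -> Prop).
Proof.
split=> [|u v|g u]; [exact: spechtZ_0 | exact: spechtZ_B |].
move: u; apply: (@spechtZ_gen n l (fun u => spechtZ l (tact g u))) => [|u v gu gv|t tl].
- by have -> : tact g 0 = 0 := gact0 (tens_mod n) g; apply: spechtZ_0.
- have -> : tact g (u - v) = tact g u - tact g v := gactB (M := tens_mod n) g u v.
  exact: spechtZ_B.
by rewrite tact_polytab; apply/mem_spechtZ/tab_wperm.
Qed.

(** ** Removing the last letter *)

Definition contract n r (v : tens n.+1) : tens n := [ffun w => v (wext w r)].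

Lemma contract_is_linear n r : linear (@contract n r).
Proof. by move=> a u v; apply/ffunP=> w; rewrite !ffunE. Qed.

HB.instance Definition _ n r :=
  GRing.isLinear.Build rat (tens n.+1) (tens n) *:%R (@contract n r) (@contract_is_linear n r).

(** A tableau of the smaller shape is completed by the last letter at the end of
    row [r]. Rows below [r] do not meet the column of that node, so they never
    contain the last letter in a term of the polytabloid. *)
Lemma contract_generated n l (r : 'I_N) (t : word n * word n) : (n < N)%N ->
  yshape N n.+1 l -> removable l r -> tab (rem_node l r) t ->
  exists v, [/\ spechtZ l v, contract r v = polytab t
    & forall q : 'I_N, (r < q)%N -> contract q v = 0].
Proof.
move=> nN sl lr tt; have [pl _ _] := sl; have sr := shape_rem_node sl (ltn_ord r) lr.
have cN : (rem_node l r r < N)%N by apply: leq_ltn_trans nN; apply: shape_le sr.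
pose c := Ordinal cN; have lE : add_node (rem_node l r) r = l by rewrite rem_nodeK //; case: lr.
have := tab_wext (erefl : rem_node l r r = c) tt; rewrite lE => tl.
exists (polytab (wext t.1 r, wext t.2 c)); split; first exact: mem_spechtZ.
  apply/ffunP=> w; rewrite ffunE asym_wext /=; first by rewrite !wres_wext wext_max eqxx.
  by move=> x; rewrite wext_max => xc xr; apply: (let: And3 tI _ _ := tl in tI); rewrite /= ?wext_max.
move=> q rq; apply/ffunP=> w; rewrite ffunE [RHS]ffunE asym_wext /=.
  by rewrite wext_max -val_eqE ltn_eqF.
move=> x; rewrite wext_max => xc xq; have [_ /(_ x) + _] := tl.
rewrite /= xc xq ltnNge; case/negP.
by rewrite (leq_trans (part_leq pl rq)) //=; case: lr => _ /(_ r); rewrite /rem_node; lia.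
Qed.

Lemma contract_integral n r (v : tens n.+1) : integral v -> integral (linfun (@contract n r) v).
Proof. by move=> vi w; rewrite lfunE ffunE. Qed.

Definition rows_down l := rev [seq r : 'I_N <- enum 'I_N | `[< removable l r >]].

Definition rows_up l := [seq r : 'I_N <- enum 'I_N | `[< part (add_node l (r : nat)) >]].

Lemma pairwise_enum (P : pred 'I_N) : pairwise (fun q r : 'I_N => (q < r)%N) (filter P (enum 'I_N)).
Proof.
apply: pairwise_filter; rewrite -(pairwise_map val ltn) val_enum_ord.
by rewrite -sorted_pairwise ?iota_ltn_sorted //; apply: ltn_trans.
Qed.

Lemma pairwise_rows_down l : pairwise (fun q r : 'I_N => (r < q)%N) (rows_down l).
Proof.
have ltT : transitive (fun q r : 'I_N => (r < q)%N) by move=> y x z xy /leq_trans; apply; exact: ltnW.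
rewrite -sorted_pairwise // rev_sorted sorted_pairwise ?pairwise_enum //.
by move=> y x z; apply: ltn_trans.
Qed.

Lemma mem_rows_down l r : r \in rows_down l -> removable l (r : nat).
Proof. by rewrite mem_rev mem_filter => /andP[/asboolP]. Qed.

Lemma mem_rows_up l r : r \in rows_up l -> part (add_node l (r : nat)).
Proof. by rewrite mem_filter => /andP[/asboolP]. Qed.

Lemma sum_rows_down l (F : nat -> nat) :
  (\sum_(r <- rows_down l) F r = \sum_(r < N | `[< removable l r >]) F r)%N.
Proof. by rewrite (perm_big _ (permEl (perm_rev _))) big_filter big_enum_cond. Qed.

Lemma sum_rows_up l (F : nat -> nat) :
  (\sum_(r <- rows_up l) F r = \sum_(r < N | `[< part (add_node l r) >]) F r)%N.
Proof. by rewrite big_filter big_enum_cond. Qed.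

Definition polytabs n l (y : tens n) := exists2 t, tab l t & polytab t = y.

Lemma contract_rows n l : (n < N)%N -> yshape N n.+1 l ->
  triangular (fun r => linfun (@contract n r)) (fun r : 'I_N => @polytabs n (rem_node l r))
    (fun q r => (r < q)%N) (rows_down l) (@spechtZ n.+1 l).
Proof.
move=> nN sl r /mem_rows_down lr y [t tt <-].
have [v [vl vt vq]] := contract_generated nN sl lr tt.
by exists v; split=> // [|q /vq]; rewrite lfunE.
Qed.

Lemma spechtQ_polytabs n l (U : {vspace tens n}) :
  (forall y, polytabs l y -> y \in U) -> (spechtQ n l <= U)%VS.
Proof. by move=> yU; apply: spechtQ_gen => t tl; apply: yU; exists t. Qed.

Lemma spechtZ_polytabs n l (P : tens n -> Prop) : P 0 ->
  (forall u v, P u -> P v -> P (u - v)) -> (forall y, polytabs l y -> P y) ->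
  forall v, spechtZ l v -> P v.
Proof. by move=> P0 PB Py; apply: spechtZ_gen => // t tl; apply: Py; exists t. Qed.

Lemma dim_rem n l : (n < N)%N -> yshape N n.+1 l ->
  (\sum_(r < N | `[< removable l r >]) \dim (spechtQ n (rem_node l r))
   <= \dim (spechtQ n.+1 l))%N.
Proof.
move=> nN sl; rewrite -(sum_rows_down l (fun r => \dim (spechtQ n (rem_node l r)))).
apply: (@sum_dim_triangular _ _ _ (fun r => linfun (@contract n r)) _ _ _
  (fun r : 'I_N => @spechtQ_polytabs n (rem_node l r)) _ _ (pairwise_rows_down l)).
move=> r rl y yr; have [x [xl xy xq]] := contract_rows nN sl rl yr.
by exists x; split=> //; case: (spechtZ_spechtQ xl).
Qed.

(** ** Adjoining a letter *)

Notation ind n := {ffun 'I_n.+1 -> tens n}.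

(** The [a]-th component of a vector of the induced module is spanned by
    tableaux in all letters but [a]; here [a] is put back in row [r]. *)
Definition adjoin n r (psi : ind n) : tens n.+1 :=
  [ffun w : word n.+1 => \sum_(a | w a == r) psi a (wres a w)].

Lemma adjoin_is_linear n r : linear (@adjoin n r).
Proof.
move=> k u v; apply/ffunP=> w; rewrite !ffunE scaler_sumr -big_split.
by apply: eq_bigr => a _; rewrite !ffunE.
Qed.

HB.instance Definition _ n r :=
  GRing.isLinear.Build rat (ind n) (tens n.+1) *:%R (@adjoin n r) (@adjoin_is_linear n r).

Definition place n (a : 'I_n.+1) (v : tens n) : ind n := [ffun b => if b == a then v else 0].

Lemma place_is_linear n a : linear (@place n a).
Proof.
by move=> k u v; apply/ffunP=> b; rewrite !ffunE; case: ifP; rewrite ?scaler0 ?addr0.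
Qed.

HB.instance Definition _ n a :=
  GRing.isLinear.Build rat (tens n) (ind n) *:%R (@place n a) (@place_is_linear n a).

Definition indQ n l : {vspace ind n} := (\sum_a linfun (@place n a) @: spechtQ n l)%VS.

Definition indZ n l (psi : ind n) := forall a, spechtZ l (psi a).

Definition ind_integral n (psi : ind n) := forall a, integral (psi a).

Lemma mem_indQ n l (psi : ind n) : (forall a, psi a \in spechtQ n l) -> psi \in indQ n l.
Proof.
move=> psiQ; have -> : psi = \sum_a linfun (@place n a) (psi a).
  apply/ffunP=> b; rewrite sum_ffunE (bigD1 b) //= big1 => [|a ab].
    by rewrite lfunE ffunE eqxx addr0.
  by rewrite lfunE ffunE eq_sym (negPf ab).
by apply: memv_sumr => a _; apply: memv_img.
Qed.

Lemma dim_indQ n l : (\dim (indQ n l) <= n.+1 * \dim (spechtQ n l))%N.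
Proof.
rewrite -[X in (X * _)%N]card_ord -sum_nat_const.
apply: (leq_trans (dimv_leq_sum _ _ _)); apply: leq_sum => a _.
by rewrite -(limg_ker_dim (linfun (@place n a)) (spechtQ n l)) leq_addl.
Qed.

(** A tableau [t] with [x0] at the end of row [r] is the image of the alternating
    sum over the letters [a] in the column of [x0] of the tableaux obtained by
    exchanging [a] and [x0] and removing [a] from the node. Putting [a] in a
    higher row instead repeats a row within that column. *)
Lemma adjoin_generated n l (r : 'I_N) (t : word n.+1 * word n.+1) : (n < N)%N ->
  yshape N n l -> part (add_node l r) -> tab (add_node l r) t ->
  exists psi, [/\ indZ l psi, adjoin r psi = polytab t
    & forall q : 'I_N, (q < r)%N -> adjoin q psi = 0].
Proof.
move=> nN sl pr tl; have [pl _ _] := sl.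
have cN : (l r < N)%N by apply: leq_ltn_trans nN; apply: shape_le sl.
have [tI tlt ts] := tl.
have [|x0 [x0r x0c]] := ts r (Ordinal cN); first by rewrite /add_node eqxx addn1.
pose sw a := wperm t.1 (tperm x0 a).
pose psi : ind n := [ffun a => if t.2 a == t.2 x0 then
  polytab (wres a (sw a), wres a t.2) *~ (-1) ^+ (x0 != a) else 0].
have psiE q : adjoin q psi = asym t.2 (wset t.1 x0 q).
  apply/ffunP=> w; rewrite asym_expand ffunE; apply: eq_bigr => a _; rewrite ffunE.
  case: ifP => _; last by rewrite ffunE.
  by case: (x0 != a); rewrite ?expr1 ?expr0 ?mulr1z ?mulrN1z ?mul1r ?mulN1r // ffunE.
exists psi; split.
- move=> a; rewrite ffunE; case: eqP => [ca|_]; last exact: spechtZ_0.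
  have tz : spechtZ l (polytab (wres a (sw a), wres a t.2)).
    have swE : wperm t.2 (tperm x0 a) = t.2.
      by apply/ffunP=> z; rewrite ffunE; case: tpermP => // ->.
    have swr : sw a a = r by rewrite ffunE tpermR.
    apply/mem_spechtZ/(@tab_wres _ _ l (sw a, t.2) a); rewrite /= swr.
      by have := tab_wperm (tperm x0 a) tl; rewrite swE.
    by rewrite ca x0c.
  case: (x0 != a); rewrite ?expr1 ?expr0 ?mulr1z ?mulrN1z //.
  by rewrite -sub0r; apply: spechtZ_B => //; apply: spechtZ_0.
- by rewrite psiE -x0r wset_id.
move=> q qr; rewrite psiE.
have [|y [yq yc]] := ts q (Ordinal cN).
  by have := part_leq pr (ltnW qr); rewrite /add_node eqxx addn1.
have yx0 : x0 != y by apply: contraTneq qr => x0y; rewrite -x0r x0y yq ltnn.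
apply: (asym_eq0 yx0); first by rewrite x0c yc.
by rewrite !ffunE eqxx eq_sym (negPf yx0) yq.
Qed.

Lemma adjoin_rows n l : (n < N)%N -> yshape N n l ->
  triangular (fun r => linfun (@adjoin n r)) (fun r : 'I_N => @polytabs n.+1 (add_node l r))
    (fun q r => (q < r)%N) (rows_up l) (@indZ n l).
Proof.
move=> nN sl r /mem_rows_up lr y [t tt <-].
have [v [vl vt vq]] := adjoin_generated nN sl lr tt.
by exists v; split=> // [|q /vq]; rewrite lfunE.
Qed.

Lemma indZ_indQ n l (psi : ind n) : indZ l psi -> psi \in indQ n l /\ ind_integral psi.
Proof.
move=> psiZ; split=> [|a]; last by case: (spechtZ_spechtQ (psiZ a)).
by apply: mem_indQ => a; case: (spechtZ_spechtQ (psiZ a)).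
Qed.

Lemma dim_add n l : (n < N)%N -> yshape N n l ->
  (\sum_(r < N | `[< part (add_node l r) >]) \dim (spechtQ n.+1 (add_node l r))
   <= n.+1 * \dim (spechtQ n l))%N.
Proof.
move=> nN sl; rewrite -(sum_rows_up l (fun r => \dim (spechtQ n.+1 (add_node l r)))).
apply: leq_trans (dim_indQ n l).
apply: (@sum_dim_triangular _ _ _ (fun r => linfun (@adjoin n r)) _ _ _
  (fun r : 'I_N => @spechtQ_polytabs n.+1 (add_node l r)) _ _ (pairwise_enum _)).
move=> r rl y yr; have [x [xl xy xq]] := adjoin_rows nN sl rl yr.
by exists x; split=> //; case: (indZ_indQ xl).
Qed.

End SpechtLattice.

(** * Branching *)

Section Branch.
Variable N : nat.
Notation tens := (tens N.+1).
Notation ind n := {ffun 'I_n.+1 -> tens n}.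

Definition dimS n l := \dim (spechtQ N.+1 n l).

Lemma dimS_branching n : (n < N)%N ->
  (forall l, yshape N.+1 n l ->
    (\sum_(r < N.+1 | `[< part (add_node l r) >]) dimS n.+1 (add_node l r) = n.+1 * dimS n l)%N)
  /\ (forall l, yshape N.+1 n.+1 l ->
    (\sum_(r < N.+1 | `[< removable l r >]) dimS n (rem_node l r) = dimS n.+1 l)%N).
Proof.
by apply: branching_eq => {}n l nN sl; [apply: dim_rem | apply: dim_add]; rewrite // ltnW.
Qed.

Definition saturated n := forall l, yshape N.+1 n l ->
  forall v : tens n, v \in spechtQ N.+1 n l -> integral v -> spechtZ l v.

Lemma filtered_contract n l : (n < N)%N -> saturated n -> yshape N.+1 n.+1 l ->
  filtered (fun r => @contract N.+1 n r) (fun r : 'I_N.+1 => @spechtZ N.+1 n (rem_node l r))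
    (rows_down N.+1 l) (@spechtZ N.+1 n.+1 l)
  /\ (forall v : tens n.+1, v \in spechtQ N.+1 n.+1 l -> integral v -> spechtZ l v).
Proof.
move=> nN sat sl.
have -> : (fun r => @contract N.+1 n r) = (fun r => linfun (@contract N.+1 n r)).
  by apply/funext=> r; apply/funext=> v; rewrite lfunE.
apply: (@filtered_saturated _ _ _ (fun r => linfun (@contract N.+1 n r)) _ _ _
  (fun r : 'I_N.+1 => @spechtQ_polytabs N.+1 n (rem_node l r)) _ _ _
  (@integralB N.+1 n.+1) (@contract_integral N.+1 n)
  (fun r : 'I_N.+1 => @spechtZ_polytabs N.+1 n (rem_node l r))).
- exact: pairwise_rows_down.
- by apply: contract_rows => //; apply: ltnW.
- exact: spechtZ_0.
- exact: spechtZ_B.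
- exact: spechtZ_spechtQ.
- by move=> r /mem_rows_down rl y; apply: sat; apply: shape_rem_node rl.
rewrite (sum_rows_down N.+1 l (fun r => \dim (spechtQ N.+1 n (rem_node l r)))).
by have [_ /(_ l sl) E] := dimS_branching nN; rewrite -[X in (X <= _)%N]/(dimS n.+1 l) -E.
Qed.

(** The images of an integral vector in the quotients of the restriction
    filtration are integral, so by induction they lift to the lattice;
    subtracting the lifts leaves a vector of the last kernel, which is 0. *)
Lemma saturatedP n : (n <= N)%N -> saturated n.
Proof.
elim: n => [_ l sl|n IHn nN l sl]; last first.
  by case: (filtered_contract nN (IHn (ltnW nN)) sl).
pose t0 : word N.+1 0 * word N.+1 0 := ([ffun x => ord0], [ffun x => ord0]).
have t0l : tab l t0.
  split=> [[]|[]|r c] //; have := shape_le r sl; rewrite leqn0 => /eqP->.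
  by rewrite ltn0.
move=> v _ vi; have := vi t0.1; set a := v _ => /intrP[m am].
have -> : v = polytab t0 *~ m.
  apply/ffunP=> w; have -> : w = t0.1 by apply/ffunP; case.
  have E (u : tens 0) : (u *~ m) t0.1 = u t0.1 *~ m.
    by apply: (morphB_Mz (phi := fun u : tens 0 => u t0.1)) => x y; rewrite !ffunE.
  rewrite E -/a am ffunE (bigD1 1%g) /=; last by rewrite wperm1.
  rewrite big1 => [|s /andP[_ /eqP[]]]; last by apply/permP; case.
  by rewrite wperm1 eqxx odd_perm1 addr0.
apply: subgroupMz (mem_spechtZ t0l); [exact: spechtZ_0 | exact: spechtZ_B].
Qed.

Lemma ind_integralB n (u v : ind n) : ind_integral u -> ind_integral v -> ind_integral (u - v).
Proof. by move=> ui vi a; rewrite !ffunE; apply: integralB. Qed.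

Lemma adjoin_integral n (r : 'I_N.+1) (psi : ind n) :
  ind_integral psi -> integral (linfun (@adjoin N.+1 n r) psi).
Proof. by move=> pi w; rewrite lfunE ffunE; apply: rpred_sum => a _; apply: pi. Qed.

Lemma filtered_adjoin n l : (n < N)%N -> yshape N.+1 n l ->
  filtered (fun r => @adjoin N.+1 n r) (fun r : 'I_N.+1 => @spechtZ N.+1 n.+1 (add_node l r))
    (rows_up N.+1 l) (@indZ N.+1 n l).
Proof.
move=> nN sl.
have -> : (fun r => @adjoin N.+1 n r) = (fun r => linfun (@adjoin N.+1 n r)).
  by apply/funext=> r; apply/funext=> v; rewrite lfunE.
apply: (proj1 (@filtered_saturated _ _ _ (fun r => linfun (@adjoin N.+1 n r)) _ _ _
  (fun r : 'I_N.+1 => @spechtQ_polytabs N.+1 n.+1 (add_node l r)) _ _ _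
  (@ind_integralB n) (@adjoin_integral n)
  (fun r : 'I_N.+1 => @spechtZ_polytabs N.+1 n.+1 (add_node l r)) _ (indQ N.+1 n l) _ _ _ _ _ _ _ _)).
- exact: pairwise_enum.
- by apply: adjoin_rows => //; apply: ltnW.
- by move=> a; rewrite ffunE; apply: spechtZ_0.
- by move=> u v ul vl a; rewrite !ffunE; apply: spechtZ_B.
- exact: indZ_indQ.
- by move=> r /mem_rows_up rl y; apply: saturatedP => //; apply: shape_add_node.
rewrite (sum_rows_up N.+1 l (fun r => \dim (spechtQ N.+1 n.+1 (add_node l r)))).
have [/(_ l sl) E _] := dimS_branching nN; rewrite [X in (_ <= X)%N]E.
exact: dim_indQ.
Qed.

(** The stabilizer of the last letter; its right cosets are indexed by the image
    of that letter. *)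
Definition iota_max n : 'S_n -> 'S_n.+1 := lift_perm ord_max ord_max.

Definition pt_max n (x : 'S_n.+1) : 'I_n.+1 := x ord_max.

Definition rep_max n (a : 'I_n.+1) : 'S_n.+1 := lift_perm ord_max a 1.

Lemma iota_maxM n : {morph @iota_max n : s t / (s * t)%g}.
Proof. by move=> s t; rewrite /iota_max -(lift_permM _ ord_max). Qed.

Lemma lift_perm_max n (x : 'S_n.+1) : {s : 'S_n | x = lift_perm ord_max (x ord_max) s}.
Proof.
apply: cid; have [g _ gK] := lift_perm_bij (@ord_max n).
pose y := (x * (rep_max (x ord_max))^-1)%g.
have yE : y ord_max = ord_max.
  rewrite permM -[X in _ (x X)]/ord_max; apply: (@perm_inj _ (rep_max (x ord_max))).
  by rewrite permKV lift_perm_id.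
exists (g y); have := gK y; rewrite inE yE eqxx => /(_ isT) gy.
rewrite -[g y]mulg1 -(lift_permM ord_max ord_max) gy.
by rewrite /y mulgKV.
Qed.

Definition kappa_max n (x : 'S_n.+1) : 'S_n := sval (lift_perm_max x).

Lemma kappa_maxE n (x : 'S_n.+1) : x = lift_perm ord_max (x ord_max) (kappa_max x).
Proof. exact: (svalP (lift_perm_max x)). Qed.

Lemma lift_perm_inj n (a b : 'I_n.+1) : injective (lift_perm a b).
Proof.
move=> s t st; apply/permP=> k; apply: (@lift_inj _ b).
by rewrite -!(lift_perm_lift a) st.
Qed.

Lemma kappa_lift n a (s : 'S_n) : kappa_max (lift_perm ord_max a s) = s.
Proof.
have := kappa_maxE (lift_perm ord_max a s); rewrite lift_perm_id.
by move/lift_perm_inj.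
Qed.

Lemma kappa_maxM n s (x : 'S_n.+1) : kappa_max (iota_max s * x)%g = (s * kappa_max x)%g.
Proof. by rewrite {1}(kappa_maxE x) /iota_max lift_permM kappa_lift. Qed.

Lemma kappa_max1 n : kappa_max (1 : 'S_n.+1)%g = 1%g.
Proof. by rewrite -(lift_perm1 ord_max) kappa_lift. Qed.

Lemma pt_maxM n s (x : 'S_n.+1) : pt_max (iota_max s * x)%g = pt_max x.
Proof. by rewrite /pt_max permM lift_perm_id. Qed.

Lemma rep_maxK n : cancel (@rep_max n) (@pt_max n).
Proof. by move=> a; rewrite /pt_max lift_perm_id. Qed.

Lemma rep_maxE n (x : 'S_n.+1) : x = (iota_max (kappa_max x) * rep_max (pt_max x))%g.
Proof. by rewrite lift_permM mulg1; apply: kappa_maxE. Qed.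

Notation res_mod n := (gres (@iota_maxM n) (tens_mod N.+1 n.+1)).
Notation ind_mod n := (coind (@iota_maxM n) (@kappa_maxM n) (@kappa_max1 n)
  (@pt_maxM n) (@rep_maxK n) (@rep_maxE n) (tens_mod N.+1 n)).

Lemma contract_equiv n r g (u : res_mod n) :
  contract r (gact g u) = gact g (contract r u : tens_mod N.+1 n).
Proof.
apply/ffunP=> w; rewrite !ffunE; congr (u _).
apply/ffunP=> x; rewrite !ffunE.
have -> : ((iota_max g)^-1 = iota_max g^-1)%g by rewrite /iota_max lift_permV.
case: (unliftP ord_max x) => [y|] ->; rewrite /iota_max ?lift_perm_lift ?lift_perm_id.
  by rewrite !liftK ffunE.
by rewrite unlift_none.
Qed.

Lemma adjoin_equiv n r g (psi : ind_mod n) :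
  adjoin r (gact g psi) = gact g (adjoin r psi : tens_mod N.+1 n.+1).
Proof.
apply/ffunP=> w; rewrite !ffunE [RHS](reindex_inj (@perm_inj _ g)) /=.
apply: eq_big => [a|a wa]; first by rewrite ffunE permK.
have rg : (rep_max a * g)%g = lift_perm ord_max (g a) (kappa_max (rep_max a * g)%g).
  by rewrite {1}(kappa_maxE (rep_max a * g)%g) permM lift_perm_id.
rewrite !ffunE /pt_max permM lift_perm_id; congr (psi _ _).
apply/ffunP=> x; rewrite !ffunE; congr (w _).
set k := kappa_max _ in rg *.
apply: (@perm_inj _ g); rewrite permKV.
by have := congr1 (fun s : 'S_n.+1 => s (lift ord_max (k^-1 x)%g)) rg;
  rewrite permM !lift_perm_lift perm1 permKV.
Qed.

(** Shapiro's lemma and the filtration of the induced module. *)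
Lemma htors_add_node p i n l : prime p -> (0 < i)%N -> (n < N)%N -> yshape N.+1 n l ->
  @htors _ (tens_mod N.+1 n) p i (@spechtZ N.+1 n l) ->
  exists2 r : 'I_N.+1, part (add_node l r)
    & @htors _ (tens_mod N.+1 n.+1) p i (@spechtZ N.+1 n.+1 (add_node l r)).
Proof.
move=> p_pr i0 nN sl lt; have st := @spechtZ_stable N.+1 n l.
have := htors_coind (@iota_maxM n) (@kappa_maxM n) (@kappa_max1 n)
  (@pt_maxM n) (@rep_maxK n) (@rep_maxE n) lt.
have stI := substable_coind (@iota_maxM n) (@kappa_maxM n) (@kappa_max1 n)
  (@pt_maxM n) (@rep_maxK n) (@rep_maxE n) st.
move=> lt'.
have [] := @htors_filtered _ (ind_mod n) (tens_mod N.+1 n.+1) _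
  (fun r => @adjoin N.+1 n r) _ p i _ _ p_pr i0 _ _ stI (filtered_adjoin nN sl) lt'.
- by move=> r u v; apply: linearB.
- by move=> r g u; apply: adjoin_equiv.
by move=> r /mem_rows_up lr rt; exists r.
Qed.

(** Transfer from the stabilizer of the last letter, of index [n.+1], and the
    filtration of the restricted module. *)
Lemma htors_rem_node p i n l : prime p -> (0 < i)%N -> (n < N)%N -> yshape N.+1 n.+1 l ->
  ~~ (p %| n.+1)%N -> @htors _ (tens_mod N.+1 n.+1) p i (@spechtZ N.+1 n.+1 l) ->
  exists2 r : 'I_N.+1, removable l r
    & @htors _ (tens_mod N.+1 n) p i (@spechtZ N.+1 n (rem_node l r)).
Proof.
move=> p_pr i0 nN sl pn lt; have st := @spechtZ_stable N.+1 n.+1 l.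
have pI : ~~ (p %| #|'I_n.+1|)%N by rewrite card_ord.
have lt' := htors_res (@iota_maxM n) (@kappa_maxM n)
  (@pt_maxM n) (@rep_maxK n) (@rep_maxE n) st p_pr pI lt.
have stR := substable_res (@iota_maxM n) st.
have [] := @htors_filtered _ (res_mod n) (tens_mod N.+1 n) _
  (fun r => @contract N.+1 n r) _ p i _ _ p_pr i0 _ _ stR
  (proj1 (filtered_contract nN (saturatedP (ltnW nN)) sl)) lt'.
- by move=> r u v; apply: linearB.
- by move=> r g u; apply: contract_equiv.
by move=> r /mem_rows_down lr rt; exists r.
Qed.

End Branch.

(** * Integral Specht modules in tensor space *)

Lemma part_of_yshape N n la : (n <= N)%N -> part_of n la -> yshape N.+1 n (nth 0%N la).
Proof.
move=> nN /andP[/andP[la_sorted la0] /eqP lan].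
have szn : (size la <= n)%N.
  rewrite -lan sumnE -sum1_size big_seq [X in (_ <= X)%N]big_seq.
  by apply: leq_sum => x xla; rewrite lt0n; apply: contraNneq la0 => <-.
split=> [k|k kN|].
- have [ks|ks] := ltnP k.+1 (size la); last by rewrite nth_default.
  by move/(sortedP 0%N): la_sorted; apply.
- by rewrite nth_default // (leq_trans szn) // (leq_trans nN) // ltnW.
rewrite -lan sumnE (big_nth 0%N) -(big_mkord xpredT (nth 0%N la)).
rewrite (@big_cat_nat _ _ _ (size la)) //=; last by rewrite (leq_trans szn) // ltnW.
by rewrite [X in (_ + X)%N]big_nat [X in (_ + X)%N]big1 ?addn0 // => k /andP[/(nth_default 0%N)].
Qed.

Lemma yshape_part_of N n l : yshape N n l ->
  exists2 mu, part_of n mu & nth 0%N mu = l.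
Proof.
move=> sl; have [pl l0 ln] := sl.
have [|m /eqP lm mmin] := @ex_minnP (fun k => l k == 0%N); first by exists N; rewrite l0.
pose mu := mkseq l m; have muE k : nth 0%N mu k = l k.
  have [km|mk] := ltnP k m; first by rewrite nth_mkseq.
  rewrite nth_default ?size_mkseq //; apply/esym/eqP.
  by rewrite -leqn0 -lm; apply: part_leq.
exists mu; last by apply/funext.
have mN : (m <= N)%N by apply: mmin; rewrite l0.
apply/andP; split; last first.
  rewrite sumnE big_map -[m in iota 0 m]subn0 -/(index_iota 0 m) -ln -(big_mkord xpredT l).
  apply/eqP; rewrite [RHS](@big_cat_nat _ _ _ m) //=.
  rewrite [X in (_ + X)%N]big_nat [X in (_ + X)%N]big1 ?addn0 // => k /andP[mk _].
  by apply/eqP; rewrite -leqn0 -lm; apply: part_leq.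
apply/andP; split.
  by apply/(sortedP 0%N) => k _; rewrite !muE; apply: pl.
apply/negP=> /(nthP 0%N)[k]; rewrite size_mkseq => km.
by rewrite muE => /eqP/mmin; rewrite leqNgt km.
Qed.

Lemma youngE la x : (x \in young la) = (x.2 < nth 0%N la x.1)%N.
Proof. by []. Qed.

Lemma in_add_node la mu r : is_part mu ->
  nth 0%N mu = add_node (nth 0%N la) r -> in_add la mu.
Proof.
move=> pmu muE; split=> //; exists (r, nth 0%N la r); first by rewrite youngE ltnn.
move=> [j c]; rewrite -[LHS]/(c < nth 0 mu j)%N muE /add_node.
rewrite -[RHS]/(((j, c) == (r, nth 0 la r)) || (c < nth 0 la j))%N xpair_eqE.
case: (j =P r) => [->|_] /=; last by rewrite addn0.
by rewrite addn1 ltnS leq_eqVlt.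
Qed.

Section Transport.
Variables (N n : nat) (la : seq nat).
Hypotheses (nN : (n <= N)%N) (la_n : part_of n la).
Let l : nat -> nat := nth 0%N la.
Let sl : yshape N.+1 n l := part_of_yshape nN la_n.
Notation word := (word N.+1 n).

(** The default [ord0] is never taken, as every letter occurs in a tableau. *)
Definition coord (f : node la -> nat) (t : tableau n la) : word :=
  [ffun x => if [pick a | val t a == x] is Some a then inord (f a) else ord0].

Definition row_word := coord (@node_row la).
Definition col_word := coord (@node_col la).

Lemma tableau_inj (t : tableau n la) : injective (val t).
Proof. by case: t => t /= /andP[/injectiveP]. Qed.

Lemma tableau_surj (t : tableau n la) x : exists a, val t a = x.
Proof. by case: t => t /= /andP[_ /forallP/(_ x)/codomP[a ->]]; exists a. Qed.

Lemma coordE f (t : tableau n la) a : coord f t (val t a) = inord (f a).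
Proof.
rewrite ffunE; case: pickP => [b /eqP/tableau_inj->//|/(_ a)].
by rewrite eqxx.
Qed.

Lemma node_row_ltn (a : node la) : (node_row a < N.+1)%N.
Proof.
have := valP a; rewrite youngE /= => al; rewrite /node_row ltnS.
by rewrite leqNgt; apply/negP=> Na; have [_ l0 _] := sl; move: al; rewrite -/(l _) l0.
Qed.

Lemma node_col_ltn (a : node la) : (node_col a < l (node_row a))%N.
Proof. exact: (valP a). Qed.

Lemma node_col_ltnN (a : node la) : (node_col a < N.+1)%N.
Proof. by rewrite (leq_trans (node_col_ltn a)) // (leq_trans (shape_le _ sl)) // ltnW. Qed.

Lemma row_wordE (t : tableau n la) a : row_word t (val t a) = node_row a :> nat.
Proof. by rewrite coordE inordK // node_row_ltn. Qed.

Lemma col_wordE (t : tableau n la) a : col_word t (val t a) = node_col a :> nat.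
Proof. by rewrite coordE inordK // node_col_ltnN. Qed.

Lemma coord_act f t s : coord f (tableau_act t s) = wperm (coord f t) s^-1%g.
Proof.
apply/ffunP=> x; have [a <-] := tableau_surj (tableau_act t s) x.
by rewrite coordE [RHS]ffunE [X in (s^-1)%g X]ffunE permK coordE.
Qed.

Lemma row_equivE (t u : tableau n la) : row_equiv t u = (row_word t == row_word u).
Proof.
apply/forallP/eqP => [tu|tu a].
  apply/ffunP=> x; apply/val_inj; have [a ax] := tableau_surj t x.
  have [b bx] := tableau_surj u x.
  rewrite -[in LHS]ax -[in RHS]bx /= !row_wordE; apply/eqP.
  by have /forallP/(_ b)/implyP := tu a; apply; rewrite ax bx.
apply/forallP=> b; apply/implyP=> /eqP ab.
by rewrite -(row_wordE t a) -(row_wordE u b) tu ab.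
Qed.

Lemma eq_tabloid_of (t u : tableau n la) : tabloid_of t = tabloid_of u <-> row_word t = row_word u.
Proof.
split=> [/(congr1 val)/= tu|tu].
  have : u \in row_class t by rewrite tu inE row_equivE.
  by rewrite inE row_equivE => /eqP.
by apply/val_inj/setP=> w; rewrite !inE !row_equivE tu.
Qed.

Definition tabloid_word (T : tabloid n la) : word := row_word (sval (cid (tabloid_ofP T))).

Lemma tabloid_word_of t : tabloid_word (tabloid_of t) = row_word t.
Proof. by apply/eq_tabloid_of; rewrite -(svalP (cid (tabloid_ofP _))). Qed.

Lemma tabloid_word_inj : injective tabloid_word.
Proof.
move=> T U; have [t ->] := tabloid_ofP T; have [u ->] := tabloid_ofP U.
by rewrite !tabloid_word_of => /eq_tabloid_of.
Qed.

Lemma tabloid_word_act T s : tabloid_word (tabloid_act T s) = wperm (tabloid_word T) s^-1%g.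
Proof.
have [t ->] := tabloid_ofP T.
by rewrite tabloid_act_of !tabloid_word_of [LHS]coord_act.
Qed.

Definition emb (v : perm_module n la) : tens N.+1 n :=
  [ffun w => \sum_T (v T)%:~R *+ (tabloid_word T == w)].

Lemma embB : {morph emb : u v / u - v}.
Proof.
move=> u v; apply/ffunP=> w; rewrite !ffunE -sumrB; apply: eq_bigr => T _.
by rewrite !ffunE intrB mulrnBl.
Qed.

Lemma emb_word v T : emb v (tabloid_word T) = (v T)%:~R :> rat.
Proof.
rewrite ffunE (bigD1 T) //= eqxx big1 ?addr0 // => U UT.
by rewrite (inj_eq tabloid_word_inj) (negPf UT).
Qed.

Lemma emb_inj : injective emb.
Proof.
move=> u v uv; apply/ffunP=> T; apply: (@intr_inj rat).
by rewrite -!emb_word uv.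
Qed.

Lemma emb_act s v : emb (perm_module_act s v) = tact s (emb v).
Proof.
apply/ffunP=> w; rewrite !ffunE.
have act_inj : injective (fun T : tabloid n la => tabloid_act T s).
  apply: (can_inj (g := fun T => tabloid_act T s^-1%g)) => T.
  by rewrite -tabloid_actM mulgV tabloid_act1.
rewrite [RHS](reindex_inj act_inj); apply: eq_bigr => T _.
by rewrite ffunE tabloid_word_act (inj_eq (@wperm_inj _ _ _)).
Qed.

Lemma emb_polytabloid t : emb (polytabloid t) = polytab (row_word t, col_word t).
Proof.
rewrite /polytabloid (big_morph emb (morphB_D embB) (morphB_0 embB)); apply/ffunP=> w.
rewrite sum_ffunE ffunE [RHS](reindex_inj invg_inj); apply: eq_big => [s|s _].
  rewrite inE /=; apply/forallP/eqP => [cs|cs a].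
    apply/ffunP=> x; rewrite ffunE; apply/val_inj.
    have [a ax] := tableau_surj t x; have [b bx] := tableau_surj t (s^-1%g x).
    rewrite -[in LHS]bx -[in RHS]ax /= !col_wordE; apply/eqP.
    by have /forallP/(_ a)/implyP := cs b; apply; rewrite bx permKV ax.
  apply/forallP=> b; apply/implyP=> /eqP ab.
  rewrite -(col_wordE t a) -(col_wordE t b) -ab.
  by have := congr1 (fun w : word => w (s (val t a))) cs; rewrite [LHS]ffunE permK => ->.
have E (u : perm_module n la) m : emb (u *~ m) w = emb u w *~ m.
  rewrite (morphB_Mz embB); apply: (morphB_Mz (phi := fun u : tens N.+1 n => u w)) => x y.
  by rewrite !ffunE.
rewrite E odd_permV [emb _ w]ffunE (bigD1 (tabloid_of (tableau_act t s))) //=.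
rewrite ffunE eqxx big1 ?addr0 => [|T Ts]; last by rewrite ffunE (negPf Ts) mul0rn.
rewrite tabloid_word_of [row_word _]coord_act.
by case: (s : bool); rewrite ?expr0 ?expr1 ?mulr1z ?mulrN1z ?mulNrn.
Qed.

Lemma node_eq (a b : node la) : node_row a = node_row b -> node_col a = node_col b -> a = b.
Proof.
rewrite /node_row /node_col => rab cab; apply/val_inj.
by move: (val a) (val b) rab cab => [a1 a2] [b1 b2] /= /val_inj-> /val_inj->.
Qed.

Lemma node_ex r c : (c < l r)%N -> {a : node la | node_row a = r & node_col a = c}.
Proof.
move=> cl; have rs : (r < size la)%N.
  by rewrite ltnNge; apply/negP=> /(nth_default 0%N) l0; move: cl; rewrite /l l0.
have ch : (c < head 0%N la)%N.
  by rewrite -nth0; apply: leq_trans cl _; case: sl => pl _ _; apply: part_leq.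
have cl' : (val (Ordinal rs), val (Ordinal ch)) \in young la by [].
by exists (Sub (Ordinal rs, Ordinal ch) cl'); rewrite /node_row /node_col /= ?SubK.
Qed.

Lemma tab_tableau t : tab l (row_word t, col_word t).
Proof.
split=> /= [x y|x|r c cl].
- have [a <-] := tableau_surj t x; have [b <-] := tableau_surj t y.
  move=> /(congr1 val) /=; rewrite !row_wordE => rab /(congr1 val) /=.
  by rewrite !col_wordE => cab; rewrite (node_eq rab cab).
- have [a <-] := tableau_surj t x; rewrite row_wordE col_wordE.
  exact: node_col_ltn.
have [a ar ac] := node_ex cl; exists (val t a).
by split; apply/val_inj; rewrite /= ?row_wordE ?col_wordE.
Qed.

Lemma tableau_tab (w : word * word) : tab l w ->
  exists t, (row_word t, col_word t) = w.
Proof.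
case: w => rho gamma [/= wI wl ws].
have /choice[f fP] (a : node la) : exists x, rho x = node_row a :> nat /\ gamma x = node_col a :> nat.
  have [|x [xr xc]] := ws (Ordinal (node_row_ltn a)) (Ordinal (node_col_ltnN a)).
    exact: node_col_ltn.
  by exists x; rewrite xr xc.
have f_tab : is_tableau [ffun a => f a].
  apply/andP; split.
    apply/injectiveP=> a b; rewrite !ffunE => fab; apply: node_eq.
      by rewrite -(proj1 (fP a)) -(proj1 (fP b)) fab.
    by rewrite -(proj2 (fP a)) -(proj2 (fP b)) fab.
  apply/forallP=> x; have [a ar ac] := node_ex (wl x).
  apply/codomP; exists a; rewrite ffunE; apply: wI; apply/val_inj.
    by rewrite /= (proj1 (fP a)).
  by rewrite /= (proj2 (fP a)).
pose t : tableau n la := exist (fun u => is_true (is_tableau u)) _ f_tab.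
have tE x : exists2 a, val t a = x & f a = x.
  by have [a ax] := tableau_surj t x; exists a => //; rewrite -ax /= ffunE.
exists t; congr (_, _); apply/ffunP=> x; apply/val_inj; have [a ax fx] := tE x.
  by rewrite -ax /= row_wordE -(proj1 (fP a)) ffunE.
by rewrite -ax /= col_wordE -(proj2 (fP a)) ffunE.
Qed.

(** ** The Specht module as a lattice of tensors *)

Let phi (v : specht_module n la) : tens_mod N.+1 n := emb (val v).

Let phiB : {morph phi : u v / u - v}.
Proof. by move=> u v; apply: embB. Qed.

Let phiG g u : phi (gact g u) = gact g (phi u).
Proof. exact: emb_act. Qed.

Lemma emb_specht (v : perm_module n la) : is_specht v -> spechtZ l (emb v).
Proof.
move=> /asboolP[c ->]; set P := fun u => spechtZ l (emb u).
have P0 : P 0 by rewrite /P (morphB_0 embB); apply: spechtZ_0.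
have PB u w : P u -> P w -> P (u - w) by rewrite /P embB; apply: spechtZ_B.
apply: (subgroup_sum P0 PB) => t _; apply: (subgroupMz P0 PB).
by rewrite /P emb_polytabloid; apply/mem_spechtZ/tab_tableau.
Qed.

Lemma specht_polytabloid t : is_specht (polytabloid t : perm_module n la).
Proof.
apply/asboolP; exists (fun u => (u == t)%:R); move: (@polytabloid n la) => F.
by rewrite (bigD1 t) //= eqxx mulr1z big1 ?addr0 // => u /negPf->.
Qed.

Lemma specht_emb (y : tens N.+1 n) : spechtZ l y ->
  exists2 v : specht_module n la, True & phi v = y.
Proof.
move: y; apply: (@spechtZ_gen N.+1 n l
  (fun y => exists2 v : specht_module n la, True & phi v = y)).
- by exists 0 => //; have := phiB 0 0; rewrite !subrr.
- by move=> _ _ [u _ <-] [v _ <-]; exists (u - v); rewrite ?phiB.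
move=> w /tableau_tab[t <-]; exists (Specht (specht_polytabloid t)) => //.
exact: emb_polytabloid.
Qed.

Lemma htors_specht p i : (0 < i)%N ->
  @htors _ (specht_module n la) p i (fun=> True) <->
  @htors _ (tens_mod N.+1 n) p i (@spechtZ N.+1 n l).
Proof.
move=> i0; apply: (htors_iso (phi := phi)) => //.
- by move=> u _; apply: emb_specht; case: u.
- exact: specht_emb.
move=> u _ u0; apply/val_inj/emb_inj; rewrite -[LHS]/(phi u) u0.
by have := phiB 0 0; rewrite !subrr.
Qed.

Lemma specht_saturated m (v : perm_module n la) : (0 < m)%N ->
  is_specht (v *+ m) -> is_specht v.
Proof.
move=> m0 /emb_specht/spechtZ_spechtQ[vQ _].
have vz : spechtZ l (emb v).
  apply: saturatedP sl _ _ _ => // [|w]; last first.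
    by rewrite ffunE; apply: rpred_sum => T _; apply/rpredMn/intr_int.
  have -> : emb v = (m%:R : rat)^-1 *: emb (v *+ m).
    by rewrite (morphB_Mn embB) -scaler_nat scalerA mulVf ?scale1r // pnatr_eq0 -lt0n.
  exact: memvZ.
have [u _ uv] := specht_emb vz.
by rewrite -(emb_inj uv); case: u {uv}.
Qed.

(** A cocycle divisible by the order of the group is |G| times a cochain, by
    saturation, and that cochain is a cocycle since the module is torsion free;
    so the cohomology class only depends on the cocycle modulo |G|. *)
Lemma finite_specht_cohomology i : (0 < i)%N ->
  finite_set [set: specht_cohomology i n la].
Proof.
case: i => // i _; pose m := #|{: 'S_n}|.
have m0 : (0 < m)%N by apply/card_gt0P; exists 1%g.
pose q (f : cochain (specht_module n la) i.+1) :
    {ffun {ffun 'I_i.+1 -> 'S_n} -> {ffun tabloid n la -> 'I_m.-1.+1}} :=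
  [ffun g => [ffun T => inord `|(val (f g) T %% m)%Z|%N]].
apply: (finite_cohomology (q := q)) => f h fz hz /ffunP qfh.
have mZ : (m%:Z != 0)%R by rewrite -lt0n in m0 *; case: (m) m0.
have dvd g T : (m %| val (f g) T - val (h g) T)%Z.
  have := congr1 val (congr1 (fun F : {ffun tabloid n la -> 'I_m.-1.+1} => F T) (qfh g)).
  have bound x : (`|(x %% m)%Z| < m.-1.+1)%N.
    by rewrite prednK // -ltz_nat gez0_abs ?modz_ge0 // ltz_pmod.
  rewrite !ffunE /= !inordK // => /(congr1 Posz).
  by rewrite !gez0_abs ?modz_ge0 // => E; rewrite -eqz_mod_dvd E.
pose u g : perm_module n la := [ffun T => ((val (f g) T - val (h g) T) %/ m)%Z].
have uE g : u g *+ m = val (f g - h g).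
  apply/ffunP=> T; rewrite !ffunE.
  have -> : (u g *+ m) T = u g T *+ m.
    by apply: (morphB_Mn (phi := fun v : perm_module n la => v T)) => x y; rewrite !ffunE.
  by rewrite ffunE -mulr_natr natz divzK.
have us g : is_specht (u g).
  by apply: (specht_saturated m0); rewrite uE; case: (f g - h g).
pose c : cochain (specht_module n la) i.+1 := [ffun g => Specht (us g)].
have cE : c *+ m = f - h.
  apply/ffunP=> g; rewrite !ffunE.
  have -> : (c *+ m) g = c g *+ m.
    apply: (morphB_Mn (phi := fun c : cochain (specht_module n la) i.+1 => c g)) => x y.
    by rewrite !ffunE.
  apply/val_inj; rewrite -uE ffunE.
  by apply: (morphB_Mn (phi := val : specht n la -> perm_module n la)).
have cz : is_cocycle c.
  have : coboundary_map (f - h) = 0.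
    by rewrite coboundary_mapB (eqP fz) (eqP hz) subrr.
  rewrite -cE (morphB_Mn (phi := @coboundary_map _ _ i.+1)) => [c0|]; last exact: coboundary_mapB.
  apply/eqP/ffunP=> g; rewrite ffunE.
  apply/val_inj/ffunP=> T; rewrite ffunE.
  have := congr1 (fun d : cochain (specht_module n la) i.+2 => val (d g) T) c0.
  rewrite (morphB_Mn (phi := fun d : cochain (specht_module n la) i.+2 => val (d g) T));
    last by move=> x y; rewrite !ffunE.
  by rewrite !ffunE => /eqP; rewrite mulrn_eq0 (gtn_eqF m0) => /eqP.
rewrite -cE; apply/homog_coboundaryP.
have [//|b Lb bE] := hcob_card _ (proj1 (homog_cocycleP c) cz).
by exists b => // s si; rewrite -bE // homogMn.
Qed.

Lemma dvd_order_specht p i : prime p -> (0 < i)%N ->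
  dvd_order p (specht_cohomology i n la) <->
  @htors _ (tens_mod N.+1 n) p i (@spechtZ N.+1 n l).
Proof.
move=> p_pr i0; split=> [/(dvd_order_htors p_pr i0)|ht].
  by move/(htors_specht p i0).
apply: htors_dvd_order => //; first exact: finite_specht_cohomology.
by apply/(htors_specht p i0).
Qed.

End Transport.

Theorem theorem1p3 (p i n : nat) (la : seq nat) :
  prime p -> (1 <= i)%N -> part_of n la -> Cset p i la ->
  (exists mu : seq nat,
     [/\ in_add la mu, successor (Cset p i) la mu
       & dvd_order p (specht_cohomology i n.+1 mu)])
  /\ (~~ (p %| n)%N ->
      exists mu : seq nat,
        [/\ in_rem la mu, predecessor (Cset p i) la mu
          & dvd_order p (specht_cohomology i n.-1 mu)]).
Proof.
move=> p_pr i0 lan Cla; have [n' lan'] := Cla.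
have -> : n' = n by case/andP: lan' => _ /eqP <-; case/andP: lan => _ /eqP.
(* Words use n + 2 rows, more than the size of any shape that occurs. *)
move=> dvd; have sl := part_of_yshape (leqnSn n) lan.
split=> [|pn].
  have /(dvd_order_specht (leqnSn n) lan p_pr i0) ht := dvd.
  have [r pr hr] := htors_add_node p_pr i0 (ltnSn n) sl ht.
  have sr := shape_add_node sl (ltn_ord r) pr.
  have [mu mun muE] := yshape_part_of sr.
  have dvd_mu : dvd_order p (specht_cohomology i n.+1 mu).
    by apply/(dvd_order_specht (leqnn n.+1) mun p_pr i0); rewrite muE.
  have add_mu : in_add la mu by apply: in_add_node muE; case/andP: mun.
  by exists mu; split=> //; split=> //; exists n.+1.
case: n => [|n] in lan dvd sl pn *; first by rewrite dvdn0 in pn.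
have /(dvd_order_specht (leqnSn n.+1) lan p_pr i0) ht := dvd.
have nN : (n < n.+2)%N by [].
have [r lr hr] := htors_rem_node p_pr i0 nN sl pn ht.
have sr := shape_rem_node sl (ltn_ord r) lr.
have [mu mun muE] := yshape_part_of sr.
have dvd_mu : dvd_order p (specht_cohomology i n mu).
  by apply/(dvd_order_specht (ltnW nN) mun p_pr i0); rewrite muE.
have add_mu : in_add mu la.
  by apply: (in_add_node (r := r)); [case/andP: lan | rewrite muE rem_nodeK //; case: lr].
exists mu; split=> //; first by split=> //; case/andP: mun.
by split=> //; exists n.
Qed.
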